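(* Let $M$ be a finitely presented monoid. Then $M$ is of type bi-$\mathrm F_2$.
   Context: For a monoid $N$ (discrete topology), an $N$-set $P$ (set with left $N$-action) is projective if every surjective $N$-equivariant map onto $P$ has an $N$-equivariant section; equivalently $P\cong\coprod_{a\in A}Ne_a$ with each $e_a\in N$ idempotent. $N$-sets are regarded as discrete $N$-spaces (an $N$-space being a space with continuous left $N$-action); $B^n$ and $S^{n-1}=\partial B^n$ carry trivial $N$-actions. A projective $N$-CW complex is an $N$-space $X=\varinjlim X_n$ (along inclusions) where $X_0=P_0$ is a projective $N$-set and, for $n\ge1$, $X_n$ is a pushout of $N$-spaces $X_n=X_{n-1}\cup_{P_n\times S^{n-1}}(P_n\times B^n)$ along an $N$-equivariant continuous map $P_n\times S^{n-1}\to X_{n-1}$, with $P_n$ a projective $N$-set. $X_n$ is $N$-finite if $P_0,\dots,P_n$ are finitely generated $N$-sets. $M$ is an $M\times M^{op}$-set via $(m_L,m_R)m=m_Lmm_R$. A bi-equivariant classifying space for $M$ is a projective $M\times M^{op}$-CW complex $X$ such that $\pi_0(X)\cong M$ as an $M\times M^{op}$-set and each component of $X$ is contractible. $M$ is of type bi-$\mathrm F_n$ ($0\le n<\infty$) if it has a bi-equivariant classifying space $X$ with $X_n$ $M\times M^{op}$-finite. *)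

(* Defs.v *)
From HB Require Import structures.
From mathcomp Require Import all_boot all_order all_algebra generic_quotient.
From mathcomp Require Import all_classical all_reals topology normedtype.

Set Implicit Arguments.
Unset Strict Implicit.
Unset Printing Implicit Defensive.

Import Order.TTheory GRing.Theory Num.Theory numFieldNormedType.Exports.

Local Open Scope classical_set_scope.
Local Open Scope ring_scope.

Definition opp_monoid (M : Type) : Type := M.
Notation "M ^op" := (opp_monoid M) (at level 2, format "M ^op") : type_scope.

Section OppMonoid.
Variable M : monoidType.

HB.instance Definition _ := Choice.on (M^op).

Lemma opp_mulA : associative (fun x y : M^op => (y * x : M)%g).
Proof. by move=> x y z; rewrite /= mulgA. Qed.

Lemma opp_mul1 : left_id (1 : M)%g (fun x y : M^op => (y * x : M)%g).
Proof. by move=> x; rewrite /= mulg1. Qed.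

Lemma opp_1mul : right_id (1 : M)%g (fun x y : M^op => (y * x : M)%g).
Proof. by move=> x; rewrite /= mul1g. Qed.

HB.instance Definition _ := isMonoid.Build (M^op) opp_mulA opp_mul1 opp_1mul.

End OppMonoid.

Section ProdMonoid.
Variables M N : monoidType.
Implicit Types x y z : (M * N)%type.

Definition prod_mul x y : M * N := ((x.1 * y.1)%g, (x.2 * y.2)%g).
Definition prod_one : M * N := (1%g, 1%g).

Lemma prod_mulA : associative prod_mul.
Proof. by move=> x y z; rewrite /prod_mul !mulgA. Qed.

Lemma prod_mul1 : left_id prod_one prod_mul.
Proof. by move=> [x1 x2]; rewrite /prod_mul !mul1g. Qed.

Lemma prod_1mul : right_id prod_one prod_mul.
Proof. by move=> [x1 x2]; rewrite /prod_mul !mulg1. Qed.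

HB.instance Definition _ :=
  isMonoid.Build (M * N)%type prod_mulA prod_mul1 prod_1mul.

End ProdMonoid.

Section Presentation.
Variables (A : choiceType) (rels : seq (seq A * seq A)).

(* The congruence on the free monoid [seq A] generated by [rels]. *)
Inductive pres_cong : seq A -> seq A -> Prop :=
| pres_rel r : r \in rels -> pres_cong r.1 r.2
| pres_refl u : pres_cong u u
| pres_sym u v : pres_cong u v -> pres_cong v u
| pres_trans u v w : pres_cong u v -> pres_cong v w -> pres_cong u w
| pres_cat u u' v v' :
    pres_cong u v -> pres_cong u' v' -> pres_cong (u ++ u') (v ++ v').

Let cong_op (u v : seq A) : bool := `[< pres_cong u v >].

Lemma cong_op_refl : reflexive cong_op.
Proof. by move=> u; apply/asboolP; exact: pres_refl. Qed.

Lemma cong_op_sym : symmetric cong_op.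
Proof. by move=> u v; apply/asboolP/asboolP; exact: pres_sym. Qed.

Lemma cong_op_trans : transitive cong_op.
Proof.
by move=> v u w /asboolP uv /asboolP vw; apply/asboolP; exact: pres_trans vw.
Qed.

Definition pres_equiv := EquivRel cong_op cong_op_refl cong_op_sym cong_op_trans.

Local Open Scope quotient_scope.

Definition pres_monoid := {eq_quot pres_equiv}.

HB.instance Definition _ := EqQuotient.on pres_monoid.
HB.instance Definition _ := Choice.on pres_monoid.

Definition pres_mul (x y : pres_monoid) : pres_monoid :=
  \pi_pres_monoid (repr x ++ repr y).
Definition pres_one : pres_monoid := \pi_pres_monoid [::].

Lemma pres_piP u v :
  reflect (\pi_pres_monoid u = \pi_pres_monoid v) `[< pres_cong u v >].
Proof. exact: (eqquotP pres_monoid u v). Qed.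

Lemma pres_repr u : pres_cong (repr (\pi_pres_monoid u)) u.
Proof. by apply/asboolP/pres_piP; rewrite reprK. Qed.

Lemma pres_mulA : associative pres_mul.
Proof.
move=> x y z; apply/pres_piP/asboolP.
apply: (@pres_trans _ ((repr x ++ repr y) ++ repr z)).
  by rewrite -catA; apply: pres_cat; [exact: pres_refl|exact: pres_repr].
by apply: pres_sym; apply: pres_cat; [exact: pres_repr|exact: pres_refl].
Qed.

Lemma pres_mul1 : left_id pres_one pres_mul.
Proof.
move=> x; rewrite -[RHS]reprK; apply/pres_piP/asboolP.
by apply: (@pres_cat _ _ [::]); [exact: pres_repr|exact: pres_refl].
Qed.

Lemma pres_1mul : right_id pres_one pres_mul.
Proof.
move=> x; rewrite -[RHS]reprK; apply/pres_piP/asboolP.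
rewrite -[X in pres_cong _ X]cats0.
by apply: pres_cat; [exact: pres_refl|exact: pres_repr].
Qed.

HB.instance Definition _ :=
  isMonoid.Build pres_monoid pres_mulA pres_mul1 pres_1mul.

End Presentation.

Definition finitely_presented (M : monoidType) : Prop :=
  exists (A : finType) (rels : seq (seq A * seq A)) (f : pres_monoid rels -> M),
    monoid.monoid_morphism f /\ bijective f.

Definition is_action (N : monoidType) (P : Type) (act : N -> P -> P) : Prop :=
  (forall p, act 1%g p = p) /\
  (forall a b p, act (a * b)%g p = act a (act b p)).

(* The choice structure on the carrier is no restriction: classically every type
   has one. It is what [discrete_topology] requires. *)
Record nset (N : monoidType) := NSet {
  nset_car :> choiceType;
  sact : N -> nset_car -> nset_car;
  sactP : is_action sact }.

Definition sequivariant (N : monoidType) (P Q : nset N) (f : P -> Q) : Prop :=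
  forall a p, f (sact a p) = sact a (f p).

Definition nset_iso (N : monoidType) (P Q : nset N) : Prop :=
  exists f : P -> Q, sequivariant f /\ bijective f.

Definition projective (N : monoidType) (P : nset N) : Prop :=
  forall (Q : nset N) (f : Q -> P), sequivariant f -> (forall p, exists q, f q = p) ->
    exists s : P -> Q, sequivariant s /\ cancel s f.

Definition fin_gen (N : monoidType) (P : nset N) : Prop :=
  exists s : seq P, forall p, exists (a : N) (q : P), q \in s /\ p = sact a q.

Section Biset.
Variable M : monoidType.

Definition bi_act (a : (M * M^op)%type) (m : M) : M := ((a.1 * m) * (a.2 : M))%g.

Lemma bi_actP : is_action bi_act.
Proof.
split=> [m|a b m]; first by rewrite /bi_act /= mul1g mulg1.
by rewrite /bi_act !mulgA.
Qed.

Definition biset : nset (M * M^op)%type := NSet bi_actP.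

End Biset.

Record nspace (N : monoidType) := NSpace {
  nspace_car :> topologicalType;
  nact : N -> nspace_car -> nspace_car;
  nactP : is_action nact;
  nact_continuous :
    continuous (fun z : discrete_topology N * nspace_car => nact z.1 z.2) }.

Record nmap (N : monoidType) (X Y : nspace N) := NMap {
  nmap_fun :> X -> Y;
  nmap_continuous : continuous nmap_fun;
  nmap_equivariant : forall a x, nmap_fun (nact a x) = nact a (nmap_fun x) }.

Definition nhomeo (N : monoidType) (X Y : nspace N) (f : nmap X Y) : Prop :=
  exists g : nmap Y X, cancel f g /\ cancel g f.

Lemma discrete_act_continuous (N : monoidType) (X : topologicalType)
    (act : N -> X -> X) : (forall a, continuous (act a)) ->
  continuous (fun z : discrete_topology N * X => act z.1 z.2).
Proof.
move=> cact [a x] U /= /(cact a x) nU.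
exists ([set a], act a @^-1` U) => /=.
  by split; [exact: (@discrete_set1 (discrete_topology N))|exact: nU].
by move=> [b y] /= [-> ].
Qed.

Section BasicSpaces.
Variable N : monoidType.

Section Disc.
Variable P : nset N.

Lemma disc_act_continuous : continuous
  (fun z : discrete_topology N * discrete_topology P => (sact z.1 z.2 : discrete_topology P)).
Proof.
apply: (@discrete_act_continuous N (discrete_topology P) (@sact N P)) => a p U nU.
have /principal_filterP Up : principal_filter (sact a p) U by [].
by have : principal_filter p (sact a @^-1` U) by exact/principal_filterP.
Qed.

Definition disc_nspace : nspace N :=
  @NSpace N (discrete_topology P) (@sact N P) (sactP P) disc_act_continuous.

End Disc.

Section Triv.
Variable Y : topologicalType.

Lemma triv_actP : is_action (fun (_ : N) (y : Y) => y).
Proof. by []. Qed.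

Lemma triv_act_continuous :
  continuous (fun z : discrete_topology N * Y => z.2).
Proof. by apply: (@discrete_act_continuous N Y (fun _ y => y)) => a y U. Qed.

Definition triv_nspace : nspace N := NSpace triv_actP triv_act_continuous.

End Triv.

Section Prod.
Variables X Y : nspace N.

Definition prod_act (a : N) (z : X * Y) : X * Y := (nact a z.1, nact a z.2).

Lemma prod_actP : is_action prod_act.
Proof.
have [X1 XM] := nactP X; have [Y1 YM] := nactP Y.
split=> [[x y]|a b [x y]]; first by rewrite /prod_act X1 Y1.
by rewrite /prod_act /= XM YM.
Qed.

Lemma nact_continuous1 (Z : nspace N) a : continuous (@nact N Z a).
Proof.
move=> x U /(@nact_continuous N Z (a, x)) [[A B] /= [/nbhs_singleton Aa xB] ABU].
by apply: filterS xB => y By; exact: (ABU (a, y)).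
Qed.

Lemma prod_act_continuous :
  continuous (fun z : discrete_topology N * (X * Y)%type => prod_act z.1 z.2).
Proof.
apply: discrete_act_continuous => a [x y]; apply: cvg_pair.
  by apply: (@continuous_comp _ _ _ fst); [exact: cvg_fst|exact: nact_continuous1].
by apply: (@continuous_comp _ _ _ snd); [exact: cvg_snd|exact: nact_continuous1].
Qed.

Definition prod_nspace : nspace N := NSpace prod_actP prod_act_continuous.

End Prod.

End BasicSpaces.

(* Pushouts and sequential colimits are taken in the category of N-spaces. *)

Definition is_pushout (N : monoidType) (A B C D : nspace N)
    (f : nmap A B) (g : nmap A C) (f' : nmap B D) (g' : nmap C D) : Prop :=
  (forall x, f' (f x) = g' (g x)) /\
  forall (Z : nspace N) (u : nmap B Z) (v : nmap C Z),
    (forall x, u (f x) = v (g x)) ->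
    exists h : nmap D Z,
      [/\ forall b, h (f' b) = u b, forall c, h (g' c) = v c &
          forall k : nmap D Z, (forall b, k (f' b) = u b) ->
            (forall c, k (g' c) = v c) -> forall d, k d = h d].

Definition is_seq_colimit (N : monoidType) (Xs : nat -> nspace N)
    (incl : forall n, nmap (Xs n) (Xs n.+1)) (X : nspace N)
    (to : forall n, nmap (Xs n) X) : Prop :=
  (forall n x, to n.+1 (incl n x) = to n x) /\
  forall (Z : nspace N) (u : forall n, nmap (Xs n) Z),
    (forall n x, u n.+1 (incl n x) = u n x) ->
    exists h : nmap X Z,
      (forall n x, h (to n x) = u n x) /\
      forall k : nmap X Z, (forall n x, k (to n x) = u n x) ->
        forall y, k y = h y.

Section CW.
Variable R : realType.

(* The Euclidean norm is spelled out because the library norm on row vectors is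
   the sup norm; the topology is the same. *)
Definition unit_ball n : set 'rV[R]_n := [set v : 'rV[R]_n | \sum_i v 0 i ^+ 2 <= 1].
Definition unit_sphere n : set 'rV[R]_n := [set v : 'rV[R]_n | \sum_i v 0 i ^+ 2 = 1].

Arguments unit_ball : clear implicits.
Arguments unit_sphere : clear implicits.

Lemma sphere_sub_ball n : unit_sphere n `<=` unit_ball n.
Proof. by move=> v; rewrite /unit_sphere /unit_ball /= => ->. Qed.

Lemma sphere_incl_continuous n : continuous (subfun (@sphere_sub_ball n)).
Proof.
apply: continuous_comp_initial.
rewrite (_ : _ \o _ = (set_val : unit_sphere n -> 'rV[R]_n)).
  exact: initial_continuous.
by apply/funext => v; rewrite /= !set_valE.
Qed.

Lemma continuous_map_snd (X Y Z : topologicalType) (f : Y -> Z) :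
  continuous f -> continuous (fun z : X * Y => (z.1, f z.2)).
Proof.
move=> cf [x y]; apply: cvg_pair; first exact: cvg_fst.
by apply: (@continuous_comp _ _ _ snd); [exact: cvg_snd|exact: cf].
Qed.

Variable N : monoidType.

Definition cells_ball (P : nset N) n : nspace N :=
  prod_nspace (disc_nspace P) (triv_nspace N (unit_ball n)).
Definition cells_sphere (P : nset N) n : nspace N :=
  prod_nspace (disc_nspace P) (triv_nspace N (unit_sphere n)).

Section CellsIncl.
Variables (P : nset N) (n : nat).

Definition cells_incl_fun (z : cells_sphere P n) : cells_ball P n :=
  (z.1, subfun (@sphere_sub_ball n) z.2).

Lemma cells_incl_continuous : continuous cells_incl_fun.
Proof.
exact: (@continuous_map_snd (discrete_topology P) (unit_sphere n) (unit_ball n)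
  _ (@sphere_incl_continuous n)).
Qed.

Lemma cells_incl_equivariant a z :
  cells_incl_fun (nact a z) = nact a (cells_incl_fun z).
Proof. by []. Qed.

Definition cells_incl : nmap (cells_sphere P n) (cells_ball P n) :=
  NMap cells_incl_continuous cells_incl_equivariant.

End CellsIncl.

(* A projective N-CW structure on X. The maps [cw_incl] need not be required to
   be embeddings: they are pushouts of the closed embeddings [cells_incl]. *)
Record projective_cw (X : nspace N) := ProjectiveCW {
  cw_cells : nat -> nset N;
  cw_projective : forall n, projective (cw_cells n);
  cw_skel : nat -> nspace N;
  cw_base : nmap (disc_nspace (cw_cells 0)) (cw_skel 0);
  cw_baseP : nhomeo cw_base;
  cw_incl : forall n, nmap (cw_skel n) (cw_skel n.+1);
  cw_attach : forall n, nmap (cells_sphere (cw_cells n.+1) n.+1) (cw_skel n);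
  cw_char : forall n, nmap (cells_ball (cw_cells n.+1) n.+1) (cw_skel n.+1);
  cw_pushout : forall n,
    is_pushout (cw_attach n) (cells_incl (cw_cells n.+1) n.+1)
               (cw_incl n) (cw_char n);
  cw_to : forall n, nmap (cw_skel n) X;
  cw_colimit : is_seq_colimit cw_incl cw_to }.

Definition skel_finite (X : nspace N) (c : projective_cw X) (n : nat) : Prop :=
  forall i, (i <= n)%N -> fin_gen (cw_cells c i).

End CW.

Section Pi0.
Variable R : realType.

Definition path_connected_to (X : topologicalType) (x y : X) : Prop :=
  exists g : R -> X,
    [/\ {within `[0, 1], continuous g}, g 0 = x & g 1 = y].

Lemma pc_refl (X : topologicalType) (x : X) : path_connected_to x x.
Proof.
exists (fun=> x); split=> //.
by apply: continuous_subspaceT => t; exact: cvg_cst.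
Qed.

Lemma within_reparam (X : topologicalType) (A B : set R) (g : R -> X) (h : R -> R) :
  continuous h -> (forall t, A t -> B (h t)) ->
  {within B, continuous g} -> {within A, continuous (g \o h)}.
Proof.
move=> ch AB /subspace_sigL_continuousP cg; apply/subspace_sigL_continuousP.
pose k (t : A) : B := exist _ (h (set_val t)) (mem_set (AB _ (set_valP t))).
have ck : continuous k.
  apply: continuous_comp_initial => t.
  apply: (@continuous_comp _ _ _ (set_val : A -> R) h); last exact: ch.
  exact: (@initial_continuous _ _ (set_val : A -> R)).
move=> t; apply: (@continuous_comp _ _ _ k (sigL B g)); first exact: ck.
exact: cg.
Qed.

Lemma pc_sym (X : topologicalType) (x y : X) :
  path_connected_to x y -> path_connected_to y x.
Proof.
move=> [g [cg g0 g1]]; exists (g \o (fun t => 1 - t)); split => /=.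
- apply: within_reparam cg.
    by move=> t; apply: cvgB; [exact: cvg_cst|exact: cvg_id].
  by move=> t /=; rewrite !in_itv /= subr_ge0 gerBl andbC.
- by rewrite subr0.
- by rewrite subrr.
Qed.

Lemma pc_trans (X : topologicalType) (x y z : X) :
  path_connected_to x y -> path_connected_to y z -> path_connected_to x z.
Proof.
move=> [g [cg g0 g1]] [h [ch h0 h1]].
pose k t := if t <= 2^-1 then g (2 * t) else h (2 * t - 1).
have two0 : 0 < 2 :> R by [].
exists k; split; last 2 first.
- by rewrite /k invr_ge0 ltW // mulr0.
- rewrite /k; case: ifPn => [|_]; last by rewrite mulr1 -[2]/(1 + 1) addrK.
  by rewrite leNgt invf_lt1 // ltr1n.
have -> : `[0, 1]%classic = `[0, 2^-1]%classic `|` `[2^-1, 1]%classic :> set R.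
  apply/seteqP; split=> t /=; rewrite !in_itv /=.
    by move=> /andP[t0 t1]; case: (leP t 2^-1) => [?|/ltW ?];
      [left|right]; apply/andP.
  move=> [/andP[t0 t1]|/andP[t0 t1]]; apply/andP; split=> //.
    by rewrite (le_trans t1)// invf_le1 // ler1n.
  by rewrite (le_trans _ t0)// invr_ge0 ltW.
have clin c : continuous (fun t : R => 2 * t - c).
  move=> t; apply: cvgB; last exact: cvg_cst.
  by apply: cvgM; [exact: cvg_cst|exact: cvg_id].
apply: withinU_continuous; [exact: itv_closed|exact: itv_closed| |].
- apply: (@subspace_eq_continuous _ _ _ (g \o (fun t => 2 * t - 0))).
    by move=> t; rewrite inE /= in_itv /= => /andP[_ t2]; rewrite /from_subspace /k /= t2 subr0.
  apply: within_reparam cg => // t /=; rewrite !in_itv /= subr0.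
  by move=> /andP[t0 t2]; rewrite mulr_ge0 ?(ltW two0) //= -ler_pdivlMl // mulr1.
- apply: (@subspace_eq_continuous _ _ _ (h \o (fun t => 2 * t - 1))).
    move=> t; rewrite inE /= in_itv /= => /andP[t2 _].
    rewrite /from_subspace /k /=; case: ifPn => // t2'.
    have -> : t = 2^-1 by apply/le_anti/andP.
    by rewrite divff ?gt_eqF // subrr h0 g1.
  apply: within_reparam ch => // t /=; rewrite !in_itv /=.
  move=> /andP[t2 t1]; rewrite subr_ge0 -ler_pdivrMl // mulr1 t2 /=.
  by rewrite lerBlDr -[1 + 1]/(2 : R) -[leRHS]mulr1 ler_pM2l.
Qed.

Definition path_component (X : topologicalType) (x : X) : set X :=
  [set y | path_connected_to x y].

Definition contractible (Y : topologicalType) : Prop :=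
  exists (y0 : Y) (H : Y * R -> Y),
    [/\ {within [set: Y] `*` `[0, 1], continuous H},
        forall y, H (y, 0) = y & forall y, H (y, 1) = y0].

Section PathEquiv.
Variable X : topologicalType.

Let pc_op (x y : X) : bool := `[< path_connected_to x y >].

Lemma pc_op_refl : reflexive pc_op.
Proof. by move=> x; apply/asboolP; exact: pc_refl. Qed.

Lemma pc_op_sym : symmetric pc_op.
Proof. by move=> x y; apply/asboolP/asboolP; exact: pc_sym. Qed.

Lemma pc_op_trans : transitive pc_op.
Proof.
by move=> y x z /asboolP xy /asboolP yz; apply/asboolP; exact: pc_trans yz.
Qed.

Definition pc_equiv := EquivRel pc_op pc_op_refl pc_op_sym pc_op_trans.

Local Open Scope quotient_scope.

Definition pi0 := {eq_quot pc_equiv}.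

HB.instance Definition _ := EqQuotient.on pi0.
HB.instance Definition _ := Choice.on pi0.

Lemma pi0P x y : reflect (\pi_pi0 x = \pi_pi0 y) `[< path_connected_to x y >].
Proof. exact: (eqquotP pi0 x y). Qed.

End PathEquiv.

Section Pi0Action.
Variables (N : monoidType) (X : nspace N).
Local Open Scope quotient_scope.

Lemma path_connected_act (a : N) (x y : X) :
  path_connected_to x y -> path_connected_to (nact a x) (nact a y).
Proof.
move=> [g [cg g0 g1]]; exists (nact a \o g); split=> /=; [|by rewrite g0|by rewrite g1].
move=> t; apply: (@continuous_comp (subspace _)); first exact: cg.
exact: nact_continuous1.
Qed.

Definition pi0_act (a : N) (c : pi0 X) : pi0 X := \pi_(pi0 X) (nact a (repr c)).

Lemma pi0_act_pi a x : pi0_act a (\pi_(pi0 X) x) = \pi_(pi0 X) (nact a x).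
Proof.
apply/pi0P/asboolP/path_connected_act/asboolP/pi0P.
by rewrite reprK.
Qed.

Lemma pi0_actP : is_action pi0_act.
Proof.
have [act1 actM] := nactP X.
split=> [c|a b c]; rewrite -[c]reprK; move: (repr c) => x.
  by rewrite pi0_act_pi act1.
by rewrite (pi0_act_pi b x) (pi0_act_pi a) pi0_act_pi actM.
Qed.

Definition pi0_nset : nset N := NSet pi0_actP.

End Pi0Action.

End Pi0.

(* [pi_0] and the components are those given by path connectedness. *)
Record bi_classifying_space (R : realType) (M : monoidType) := BiClassifyingSpace {
  bcs_space :> nspace (M * M^op)%type;
  bcs_cw : projective_cw R bcs_space;
  bcs_pi0 : nset_iso (pi0_nset R bcs_space) (biset M);
  bcs_contractible : forall x : bcs_space, contractible R (path_component R x) }.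

Definition type_bi_F (R : realType) (n : nat) (M : monoidType) : Prop :=
  exists X : bi_classifying_space R M, skel_finite (bcs_cw X) n.

(* Main.v *)
From HB Require Import structures.
Require Import Defs.
From mathcomp Require Import all_boot all_order all_algebra generic_quotient.
From mathcomp Require Import all_classical all_reals topology normedtype realfun.
From mathcomp Require Import ring lra.

Set Implicit Arguments.
Unset Strict Implicit.
Unset Printing Implicit Defensive.

Import Order.TTheory GRing.Theory Num.Theory numFieldNormedType.Exports.

(** Write N for M x M^op. Let A generate M subject to the finite set of relations.
    The classifying space is built skeleton by skeleton from free cells N x J,
    and contracted at the same time.

    The 0-cells are the pairs (m, m') in N. For each letter x there is a free orbit
    of 1-cells, one of them joining (1, x) to (x, 1), so that the N-translate by
    (m, m') joins (m, x m') to (m x, m'). Multiplication (m, m') |-> m m' is constant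
    along edges, and a word w spells a path from (1, w) to (w, 1). Each relation
    u = v gives a free orbit of 2-cells, spanning the bigon formed by the paths of u
    and v. From dimension 3 on, a free orbit of cells is attached along every map
    of a sphere into the previous skeleton; these skeleta are infinite, which is
    harmless since finiteness is only asked up to dimension 2.

    All maps and cells respect an equivariant map deg to the discrete N-set M,
    extending multiplication. Two points in one path component have the same degree
    ([deg_path]), and if the space contracts onto one point of each degree
    then its components are the fibres of deg, hence contractible and in bijection
    with M ([pi0_iso], [component_contractible]). So it is enough to contract.

    The contraction is a compatible family of homotopies H_n from the inclusion
    X_n -> X_{n+1} to the map sending x to the base vertex (1, deg x). By
    the universal property of the pushout, extending H_n to H_{n+1} means filling,
    for each (n+1)-cell, a cylinder whose boundary is prescribed
    ([extend_contraction]). The boundary of the cylinder on B^{n+1} is an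
    (n+1)-sphere in X_{n+1}. If n + 2 >= 3, that sphere bounds a cell of X_{n+2}
    by construction ([all_spheres_fillable]). For H_0, the vertex (m, m') runs back along the
    path of a normal form of m. For H_1, the square over the edge (m, x, m') has to
    compare the path of (normal form of m) x with the path of the normal form of m x;
    these words are congruent, and congruent words have homotopic paths in X_2
    ([htp_cong], by induction on the congruence, the 2-cells giving the base case),
    whence [fill_edge].

    Only universal properties of the skeleta are used. Those for spaces of the form
    X x R, needed to define homotopies cell by cell, follow by currying into the
    space of paths with the compact-open topology ([at_lift_homotopy]). *)

Local Open Scope classical_set_scope.
Local Open Scope ring_scope.

(** * Continuity of elementary maps *)

Section RealFunctions.
Variables (R : realType) (T : topologicalType).
Implicit Types f g : T -> R.

Lemma fun_cst_continuous (Z : topologicalType) (z : Z) : continuous (fun _ : T => z).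
Proof. by move=> x; exact: cvg_cst. Qed.

Lemma fun_addr_continuous f g :
  continuous f -> continuous g -> continuous (fun x => f x + g x).
Proof. by move=> cf cg x; apply: cvgD; [exact: cf|exact: cg]. Qed.

Lemma fun_oppr_continuous f : continuous f -> continuous (fun x => - f x).
Proof. by move=> cf x; apply: cvgN; exact: cf. Qed.

Lemma fun_mulr_continuous f g :
  continuous f -> continuous g -> continuous (fun x => f x * g x).
Proof. by move=> cf cg x; apply: cvgM; [exact: cf|exact: cg]. Qed.

Lemma fun_expr_continuous f n : continuous f -> continuous (fun x => f x ^+ n).
Proof.
move=> cf; elim: n => [|n IHn]; first exact: fun_cst_continuous.
rewrite (_ : (fun _ => _) = fun x => f x * f x ^+ n); first exact: fun_mulr_continuous.
by apply/funext => x; rewrite exprS.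
Qed.

Lemma fun_maxr_continuous f g :
  continuous f -> continuous g -> continuous (fun x => Num.max (f x) (g x)).
Proof. by move=> cf cg x; apply: continuous_max; [exact: cf|exact: cg]. Qed.

Lemma fun_minr_continuous f g :
  continuous f -> continuous g -> continuous (fun x => Num.min (f x) (g x)).
Proof. by move=> cf cg x; apply: continuous_min; [exact: cf|exact: cg]. Qed.

Lemma fun_sqrtr_continuous f : continuous f -> continuous (fun x => Num.sqrt (f x)).
Proof.
by move=> cf x; apply: (continuous_comp (cf x)); exact: sqrt_continuous.
Qed.

Lemma fun_invr_continuous f :
  (forall x, f x != 0) -> continuous f -> continuous (fun x => (f x)^-1).
Proof. by move=> f0 cf x; apply: cvgV; [exact: f0|exact: cf]. Qed.

Lemma fun_sum_continuous (I : finType) (F : I -> T -> R) :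
  (forall i, continuous (F i)) -> continuous (fun x => \sum_i F i x).
Proof.
move=> cF; elim: (index_enum I) => [|i s IHs].
  rewrite (_ : (fun _ => _) = fun=> 0); first exact: fun_cst_continuous.
  by apply/funext => x; rewrite big_nil.
rewrite (_ : (fun _ => _) = fun x => F i x + \sum_(j <- s) F j x).
  exact: fun_addr_continuous.
by apply/funext => x; rewrite big_cons.
Qed.

End RealFunctions.

Lemma continuous_after (X Y Z : topologicalType) (f : X -> Y) (g : Y -> Z) :
  continuous f -> continuous g -> continuous (fun x => g (f x)).
Proof. by move=> cf cg x; apply: (continuous_comp (cf x)); exact: cg. Qed.

Lemma fun_pair_continuous (X Y Z : topologicalType) (f : X -> Y) (g : X -> Z) :
  continuous f -> continuous g -> continuous (fun x => (f x, g x)).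
Proof. by move=> cf cg x; apply: cvg_pair; [exact: cf|exact: cg]. Qed.

Lemma fst_continuous (X Y : topologicalType) : continuous (@fst X Y).
Proof. by move=> x; exact: cvg_fst. Qed.

Lemma snd_continuous (X Y : topologicalType) : continuous (@snd X Y).
Proof. by move=> x; exact: cvg_snd. Qed.

Lemma set_val_continuous (X : topologicalType) (A : set X) :
  continuous (set_val : A -> X).
Proof. exact: (@initial_continuous _ _ (set_val : A -> X)). Qed.

Lemma continuous_to_set (X Y : topologicalType) (A : set Y) (f : X -> A) :
  continuous (fun x => set_val (f x)) -> continuous f.
Proof. exact: continuous_comp_initial. Qed.

Definition in_set_type (X : Type) (A : set X) (x : X) (Ax : A x) : A :=
  exist _ x (mem_set Ax).

Lemma in_set_typeE (X : Type) (A : set X) (x : X) (Ax : A x) :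
  set_val (in_set_type Ax) = x.
Proof. by rewrite set_valE. Qed.

Lemma set_val_inj (X : Type) (A : set X) : injective (set_val : A -> X).
Proof. by move=> x y; rewrite set_valE; exact: val_inj. Qed.

(** Pasting for maps defined on subtypes: the pieces [f] and [g] may be given by
    formulas that make sense only on [A] and on [B]. *)
Lemma paste (X Z : topologicalType) (A B : set X) (f : A -> Z) (g : B -> Z) :
  closed A -> closed B -> (forall x, A x \/ B x) ->
  continuous f -> continuous g ->
  (forall a b, set_val a = set_val b -> f a = g b) ->
  exists h : X -> Z, [/\ continuous h, forall a, h (set_val a) = f a &
    forall b, h (set_val b) = g b].
Proof.
move=> clA clB AB cf cg fg.
have B_notA x : ~ A x -> B x by case: (AB x).
pose h x := match pselect (A x) with
  | left Ax => f (in_set_type Ax)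
  | right nAx => g (in_set_type (B_notA _ nAx)) end.
have hA a : h (set_val a) = f a.
  rewrite /h; case: pselect => [Aa|]; last by case; exact: set_valP.
  by congr f; apply: set_val_inj; rewrite in_set_typeE.
have hB b : h (set_val b) = g b.
  rewrite /h; case: pselect => [Ab|nAb].
    by apply: fg; rewrite in_set_typeE.
  by congr g; apply: set_val_inj; rewrite in_set_typeE.
exists h; split=> //; apply/continuous_subspace_setT.
rewrite (_ : setT = A `|` B); last by apply/seteqP; split=> x //= _; exact: AB.
apply: withinU_continuous => //; apply/subspace_sigL_continuousP.
- by rewrite (_ : sigL A h = f) //; apply/funext => a; exact: hA.
- by rewrite (_ : sigL B h = g) //; apply/funext => b; exact: hB.
Qed.

Lemma closed_le0 (R : realType) (X : topologicalType) (c : X -> R) :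
  continuous c -> closed [set x | c x <= 0].
Proof.
by move=> cc; apply: (@closed_comp _ _ c [set r | r <= 0]) => //; exact: closed_le.
Qed.

Lemma closed_ge0 (R : realType) (X : topologicalType) (c : X -> R) :
  continuous c -> closed [set x | 0 <= c x].
Proof.
by move=> cc; apply: (@closed_comp _ _ c [set r | 0 <= r]) => //; exact: closed_ge.
Qed.

Lemma if_continuous (R : realType) (X Z : topologicalType) (c d : X -> R)
    (f g : X -> Z) :
  continuous c -> continuous d -> continuous f -> continuous g ->
  (forall x, c x = d x -> f x = g x) ->
  continuous (fun x => if c x <= d x then f x else g x).
Proof.
move=> cc cd cf cg fg.
pose A := [set x | c x - d x <= 0]; pose B := [set x | 0 <= c x - d x].
have ce : continuous (fun x => c x - d x).
  by apply: fun_addr_continuous => //; exact: fun_oppr_continuous.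
have [||x||||h [ch hA hB]] :=
    @paste X Z A B (fun a => f (set_val a)) (fun a => g (set_val a)).
- exact: closed_le0.
- exact: closed_ge0.
- by rewrite /A /B /=; case: (leP (c x - d x) 0) => [|/ltW]; [left|right].
- by apply: continuous_after => //; exact: set_val_continuous.
- by apply: continuous_after => //; exact: set_val_continuous.
- move=> a b ab; rewrite -ab; apply: fg; apply/eqP; rewrite -subr_eq0 eq_le.
  by rewrite (set_valP a) {1}ab ab (set_valP b).
- rewrite (_ : (fun _ => _) = h) //; apply/funext => x.
  case: leP => [cd0|/ltW dc].
    have Ax : A x by rewrite /A /= subr_le0.
    by rewrite -{2}(in_set_typeE Ax) hA in_set_typeE.
  have Bx : B x by rewrite /B /= subr_ge0.
  by rewrite -{2}(in_set_typeE Bx) hB in_set_typeE.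
Qed.

Lemma discrete_fun_continuous (D : choiceType) (Z : topologicalType) (f : D -> Z) :
  continuous (f : discrete_topology D -> Z).
Proof.
move=> p U /nbhs_singleton Ufp.
by have : principal_filter p (f @^-1` U) by exact/principal_filterP.
Qed.

Lemma discrete_prod_continuous (D : choiceType) (Y Z : topologicalType)
    (f : D -> Y -> Z) :
  (forall d, continuous (f d)) ->
  continuous (fun z : discrete_topology D * Y => f z.1 z.2).
Proof.
move=> cf [d y] U /= /(cf d y) nU; exists ([set d], f d @^-1` U) => /=.
  by split; [exact: (@discrete_set1 (discrete_topology D))|exact: nU].
by move=> [e z] /= [-> ].
Qed.

Lemma discrete_path_constant (R : realType) (D : choiceType)
    (g : R -> discrete_topology D) :
  {within `[0, 1], continuous g} -> g 0 = g 1.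
Proof.
move=> cg; pose I := `[0, 1]%classic : set R.
have conn := connected_continuous_connected (@segment_connected R 0 1) cg.
have in0 : (g @` I) (g 0) by exists 0; rewrite // /I /= in_itv /= lexx ler01.
have in1 : (g @` I) (g 1) by exists 1; rewrite // /I /= in_itv /= lexx ler01.
have clopen (C : set (discrete_topology D)) : open C by exact: discrete_open.
have full : (g @` I) `&` [set g 0] = g @` I.
  apply: conn.
  - by exists (g 0).
  - by exists [set g 0].
  - by exists [set g 0]; rewrite // -[X in closed X]setCK; exact: open_closedC.
by move: in1; rewrite -full => -[_ /= ->].
Qed.

Lemma continuous_section (X Y Z : topologicalType) (f : X -> Y -> Z) x :
  continuous (fun z : X * Y => f z.1 z.2) -> continuous (f x).
Proof.
move=> cf; apply: (@continuous_after _ _ _ (fun t => (x, t)) _ _ cf).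
apply: fun_pair_continuous; first exact: fun_cst_continuous.
by move=> t; exact: cvg_id.
Qed.

(** For the locally compact [R], a homotopy [X * R -> Z] is the same as a map from
    [X] to the space of paths in [Z]. *)
Section Currying.
Variables (R : realType) (X Z : topologicalType).

Lemma curry_path_continuous (h : X -> R -> Z) :
  continuous (fun z : X * R => h z.1 z.2) ->
  continuous (h : X -> {compact-open, R -> Z}).
Proof.
by move=> ch; exact: (@continuous_curry_fun X R Z _ ch).
Qed.

Lemma uncurry_path_continuous (h : X -> R -> Z) :
  continuous (h : X -> {compact-open, R -> Z}) -> (forall x, continuous (h x)) ->
  continuous (fun z : X * R => h z.1 z.2).
Proof.
move=> ch chx.
have -> : (fun z : X * R => h z.1 z.2) = uncurry h by apply/funext => -[].
apply: (@continuous_uncurry X R Z) => //; exact: locally_compactR.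
Qed.

End Currying.

Section Clamp.
Variable R : realType.

(** Homotopies below are defined for every real time and are constant outside the
    unit interval; precomposing with the retraction of [R] onto the unit
    interval avoids continuity on subspaces. *)
Definition clamp (t : R) : R := Num.max 0 (Num.min t 1).

Lemma clamp_le0 t : t <= 0 -> clamp t = 0.
Proof. by move=> t0; rewrite /clamp min_l ?max_l // (le_trans t0 ler01). Qed.

Lemma clamp_ge1 t : 1 <= t -> clamp t = 1.
Proof. by move=> t0; rewrite /clamp min_r ?max_r // ler01. Qed.

Lemma clamp_id t : 0 <= t <= 1 -> clamp t = t.
Proof. by rewrite /clamp => /andP[t0 t1]; rewrite min_l ?max_r. Qed.

Lemma clamp_itv t : 0 <= clamp t <= 1.
Proof.
have [t0|t0] := leP t 0; first by rewrite clamp_le0 // lexx ler01.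
have [t1|t1] := leP t 1; first by rewrite clamp_id (ltW t0) t1.
by rewrite clamp_ge1 ?(ltW t1) // lexx ler01.
Qed.

Lemma fun_clamp_continuous (T : topologicalType) (f : T -> R) :
  continuous f -> continuous (fun x => clamp (f x)).
Proof.
move=> cf; apply: fun_maxr_continuous; first exact: fun_cst_continuous.
by apply: fun_minr_continuous => //; exact: fun_cst_continuous.
Qed.
End Clamp.

(** The dispatch is on the head symbol: trying all the lemmas in turn makes
    unification unfold the hierarchy of structures. *)
Ltac continuity_step :=
  lazymatch goal with
  | |- forall x, continuous_at x (fun _ => ?z) => exact: fun_cst_continuous
  | |- forall x, continuous_at x (fun y => Algebra.add (@?f y) (@?g y)) =>
      apply: (@fun_addr_continuous _ _ f g)
  | |- forall x, continuous_at x (fun y => Algebra.opp (@?f y)) =>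
      apply: (@fun_oppr_continuous _ _ f)
  | |- forall x, continuous_at x (fun y => GRing.mul (@?f y) (@?g y)) =>
      apply: (@fun_mulr_continuous _ _ f g)
  | |- forall x, continuous_at x (fun y => GRing.exp (@?f y) ?n) =>
      apply: (@fun_expr_continuous _ _ f n)
  | |- forall x, continuous_at x (fun y => clamp (@?f y)) =>
      apply: (@fun_clamp_continuous _ _ f)
  | |- forall x, continuous_at x (fun y => Num.sqrt (@?f y)) =>
      apply: (@fun_sqrtr_continuous _ _ f)
  | |- forall x, continuous_at x (fun y => (@?f y, @?g y)) =>
      apply: (@fun_pair_continuous _ _ _ f g)
  | |- forall x, continuous_at x (fun y => y) => by move=> ?; exact: cvg_id
  | |- forall x, continuous_at x (fun y => fst y) => exact: fst_continuous
  | |- forall x, continuous_at x (fun y => snd y) => exact: snd_continuous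
  | |- forall x, continuous_at x fst => exact: fst_continuous
  | |- forall x, continuous_at x snd => exact: snd_continuous
  | |- forall x, continuous_at x set_val => exact: set_val_continuous
  | |- forall x, continuous_at x (fun y => set_val y) => exact: set_val_continuous
  | |- _ => assumption
  end.

Ltac cont := repeat continuity_step.

(** * Quotients, pushouts and sequential colimits of N-spaces *)

(** The lifting property is stated for arbitrary continuous maps: homotopies
    and contractions are not equivariant. Equivariance of the lift of an
    equivariant map follows from surjectivity of the projection. *)
Record quotient_nspace (N : monoidType) (T : nspace N) (r : T -> T -> Prop) :=
  QuotientNSpace {
    quo : nspace N;
    quo_pi : nmap T quo;
    quo_surj : forall y, exists x, quo_pi x = y;
    quo_rel : forall x y, r x y -> quo_pi x = quo_pi y;
    quo_lift : forall (Z : topologicalType) (h : T -> Z), continuous h ->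
      (forall x y, r x y -> h x = h y) ->
      exists h' : quo -> Z, continuous h' /\ forall x, h' (quo_pi x) = h x }.

Section QuotientNSpace.
Variables (N : monoidType) (T : nspace N) (r : T -> T -> Prop).
Hypothesis r_act : forall a x y, r x y -> r (nact a x) (nact a y).

Definition is_equivalence (X : Type) (e : X -> X -> Prop) : Prop :=
  [/\ forall x, e x x, forall x y, e x y -> e y x &
      forall x y z, e x y -> e y z -> e x z].

(** The equivalence relation generated by [r], as the intersection of all the
    equivalence relations containing it; with this form a function that
    respects [r] visibly respects the generated relation. *)
Definition generated (x y : T) : Prop :=
  forall e, is_equivalence e -> (forall u v, r u v -> e u v) -> e x y.

Let generatedb (x y : T) : bool := `[< generated x y >].

Lemma generated_refl : reflexive generatedb.
Proof. by move=> x; apply/asboolP => e [e1 _ _] _. Qed.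

Lemma generated_sym : symmetric generatedb.
Proof.
move=> x y; apply/asboolP/asboolP => g e ee re; have [_ es _] := ee.
  by apply: es; exact: g.
by apply: es; exact: g.
Qed.

Lemma generated_trans : transitive generatedb.
Proof.
move=> y x z /asboolP xy /asboolP yz; apply/asboolP => e ee re.
by have [_ _ et] := ee; apply: (et _ y); [exact: xy|exact: yz].
Qed.

Definition generated_equiv :=
  EquivRel generatedb generated_refl generated_sym generated_trans.

Local Open Scope quotient_scope.
Local Notation Q := (quotient_topology {eq_quot generated_equiv}).

Lemma generated_piP (x y : T) : (\pi_Q x = \pi_Q y) <-> generated x y.
Proof.
split=> [/(eqquotP {eq_quot generated_equiv} x y)/asboolP//|g].
by apply/(eqquotP {eq_quot generated_equiv} x y)/asboolP.
Qed.

Lemma generated_act a x y : generated x y -> generated (nact a x) (nact a y).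
Proof.
move=> g e ee re; apply: (g (fun u v => e (nact a u) (nact a v))).
  by have [e1 es et] := ee; split=> [u|u v|u v w]; [exact: e1|exact: es|exact: et].
by move=> u v ruv; apply: re; exact: r_act.
Qed.

Definition quo_act (a : N) (q : Q) : Q := \pi_Q (nact a (repr q)).

Lemma quo_act_pi a x : quo_act a (\pi_Q x) = \pi_Q (nact a x).
Proof.
by apply/generated_piP; apply: generated_act; apply/generated_piP; rewrite reprK.
Qed.

Lemma quo_actP : is_action quo_act.
Proof.
have [act1 actM] := nactP T; split=> [q|a b q]; rewrite -[q]reprK; move: (repr q) => x.
  by rewrite quo_act_pi act1.
by rewrite (quo_act_pi b x) (quo_act_pi a) quo_act_pi actM.
Qed.

Lemma quo_act_continuous :
  continuous (fun z : discrete_topology N * Q => quo_act z.1 z.2).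
Proof.
apply: (@discrete_act_continuous N Q) => a; apply/quotient_continuous.
rewrite (_ : _ \o _ = \pi_Q \o nact a).
  by move=> x; apply: continuous_comp; [exact: nact_continuous1|exact: pi_continuous].
by apply/funext => x; rewrite /= quo_act_pi.
Qed.

Definition quo_nspace : nspace N := NSpace quo_actP quo_act_continuous.

Lemma nspace_quotient : quotient_nspace r.
Proof.
pose p : nmap T quo_nspace :=
  @NMap N T quo_nspace (fun x => \pi_Q x) (@pi_continuous T _)
        (fun a x => esym (quo_act_pi a x)).
apply: (@QuotientNSpace N T r quo_nspace p) => [y|x y rxy|Z h ch rh].
- by exists (repr (y : Q)); rewrite /= reprK.
- by apply/generated_piP => e _; apply.
have hr x : h (repr (\pi_Q x)) = h x.
  have : generated (repr (\pi_Q x)) x by apply/generated_piP; rewrite reprK.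
  move=> /(_ (fun u v => h u = h v)); apply=> //.
  by split=> [|u v ->|u v w -> ->].
exists (fun q : Q => h (repr q)); split=> [|x]; last exact: hr.
apply/quotient_continuous; rewrite (_ : _ \o _ = h) //.
by apply/funext => x; exact: hr.
Qed.

End QuotientNSpace.

Section Coproduct.
Variables (N : monoidType) (I : choiceType) (F : I -> nspace N).

Definition coprod_act (a : N) (z : {i : I & F i}) : {i : I & F i} :=
  existT (fun i => F i) (projT1 z) (nact a (projT2 z)).

Lemma coprod_actP : is_action coprod_act.
Proof.
split=> [[i x]|a b [i x]]; rewrite /coprod_act /=.
  by rewrite (nactP (F i)).1.
by rewrite (nactP (F i)).2.
Qed.

Lemma coprod_lift_continuous (Z : topologicalType) (f : forall i, F i -> Z) :
  (forall i, continuous (f i)) ->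
  continuous (fun z : {i : I & F i} => f (projT1 z) (projT2 z)).
Proof. by move=> cf [i x] U /= /(cf i x). Qed.

Lemma coprod_act_continuous :
  continuous (fun z : discrete_topology N * {i : I & F i} => coprod_act z.1 z.2).
Proof.
apply: discrete_act_continuous => a; apply: (@coprod_lift_continuous _
  (fun i x => existT (fun i => F i) i (nact a x))) => i.
apply: continuous_after; first exact: nact_continuous1.
exact: existT_continuous.
Qed.

Definition coprod_nspace : nspace N := NSpace coprod_actP coprod_act_continuous.

Definition coprod_in i : nmap (F i) coprod_nspace :=
  @NMap N (F i) coprod_nspace (existT (fun i => F i) i)
    (@existT_continuous I F i) (fun _ _ => erefl).

End Coproduct.

Section PushoutColimit.
Variable N : monoidType.

Record pushout_nspace (A B C : nspace N) (f : nmap A B) (g : nmap A C) :=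
  PushoutNSpace {
    po : nspace N;
    po_inl : nmap B po;
    po_inr : nmap C po;
    po_surj : forall y, (exists b, po_inl b = y) \/ (exists c, po_inr c = y);
    po_glue : forall x, po_inl (f x) = po_inr (g x);
    po_lift : forall (Z : topologicalType) (u : B -> Z) (v : C -> Z),
      continuous u -> continuous v -> (forall x, u (f x) = v (g x)) ->
      exists h : po -> Z, [/\ continuous h, forall b, h (po_inl b) = u b &
        forall c, h (po_inr c) = v c] }.

Lemma nspace_pushout (A B C : nspace N) (f : nmap A B) (g : nmap A C) :
  pushout_nspace f g.
Proof.
pose F (b : bool) := if b then B else C.
pose T := coprod_nspace F.
pose inB (b : B) : T := existT (fun i => F i) true b.
pose inC (c : C) : T := existT (fun i => F i) false c.
pose r (s t : T) : Prop := exists x, s = inB (f x) /\ t = inC (g x).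
have r_act a s t : r s t -> r (nact a s) (nact a t).
  move=> [x [-> ->]]; exists (nact a x).
  by rewrite /inB /inC !nmap_equivariant.
have [Q p psurj prel plift] := nspace_quotient r_act.
pose iB : nmap B Q := NMap
  (continuous_after (@nmap_continuous _ _ _ (coprod_in F true))
                    (@nmap_continuous _ _ _ p))
  (fun a x => nmap_equivariant p a (inB x)).
pose iC : nmap C Q := NMap
  (continuous_after (@nmap_continuous _ _ _ (coprod_in F false))
                    (@nmap_continuous _ _ _ p))
  (fun a x => nmap_equivariant p a (inC x)).
apply: (@PushoutNSpace A B C f g Q iB iC) => [y|x|Z u v cu cv uv].
- by have [[[] t] <-] := psurj y; [left|right]; exists t.
- by apply: prel; exists x.
pose h (i : bool) : F i -> Z := match i with true => u | false => v end.
have [|s t [x [-> ->]]|k [ck kE]] := plift Z (fun t : T => h (projT1 t) (projT2 t)).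
- by apply: coprod_lift_continuous => -[].
- exact: uv.
by exists k; split=> // [b|c]; [exact: (kE (inB b))|exact: (kE (inC c))].
Qed.

Lemma pushout_nspaceP (A B C : nspace N) (f : nmap A B) (g : nmap A C)
  (D : pushout_nspace f g) : is_pushout f g (po_inl D) (po_inr D).
Proof.
split=> [|Z u v uv]; first exact: po_glue.
have [h [ch hu hv]] :=
  po_lift D (@nmap_continuous _ _ _ u) (@nmap_continuous _ _ _ v) uv.
have hN a y : h (nact a y) = nact a (h y).
  have [[b <-]|[c <-]] := po_surj y.
    by rewrite -nmap_equivariant !hu nmap_equivariant.
  by rewrite -nmap_equivariant !hv nmap_equivariant.
exists (NMap ch hN); split=> // k ku kv d.
by have [[b <-]|[c <-]] := po_surj d; rewrite ?ku ?kv /= ?hu ?hv.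
Qed.

Record seq_colimit_nspace (Xs : nat -> nspace N)
    (incl : forall n, nmap (Xs n) (Xs n.+1)) :=
  SeqColimitNSpace {
    colim : nspace N;
    colim_in : forall n, nmap (Xs n) colim;
    colim_surj : forall y, exists n x, colim_in n x = y;
    colim_incl : forall n x, colim_in n.+1 (incl n x) = colim_in n x;
    colim_lift : forall (Z : topologicalType) (u : forall n, Xs n -> Z),
      (forall n, continuous (u n)) -> (forall n x, u n.+1 (incl n x) = u n x) ->
      exists h : colim -> Z,
        continuous h /\ forall n x, h (colim_in n x) = u n x }.

Lemma nspace_seq_colimit (Xs : nat -> nspace N)
  (incl : forall n, nmap (Xs n) (Xs n.+1)) : seq_colimit_nspace incl.
Proof.
pose T := coprod_nspace Xs.
pose inX n (x : Xs n) : T := existT (fun i => Xs i) n x.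
pose r (s t : T) : Prop := exists n x, s = @inX n.+1 (incl n x) /\ t = @inX n x.
have r_act a s t : r s t -> r (nact a s) (nact a t).
  by move=> [n [x [-> ->]]]; exists n, (nact a x); rewrite /inX nmap_equivariant.
have [Q p psurj prel plift] := nspace_quotient r_act.
pose iX n : nmap (Xs n) Q := NMap
  (continuous_after (@nmap_continuous _ _ _ (coprod_in Xs n))
                    (@nmap_continuous _ _ _ p))
  (fun a x => nmap_equivariant p a (inX n x)).
apply: (@SeqColimitNSpace Xs incl Q iX) => [y|n x|Z u cu uE].
- by have [[n x] <-] := psurj y; exists n, x.
- by apply: prel; exists n, x.
have [|s t [n [x [-> ->]]]|k [ck kE]] := plift Z (fun t : T => u (projT1 t) (projT2 t)).
- exact: coprod_lift_continuous.
- exact: uE.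
by exists k; split=> // n x; exact: (kE (inX n x)).
Qed.

Lemma seq_colimit_nspaceP (Xs : nat -> nspace N)
    (incl : forall n, nmap (Xs n) (Xs n.+1)) (X : seq_colimit_nspace incl) :
  is_seq_colimit incl (colim_in X).
Proof.
split=> [|Z u uE]; first exact: colim_incl.
have [h [ch hE]] := colim_lift X (fun n => @nmap_continuous _ _ _ (u n)) uE.
have hN a y : h (nact a y) = nact a (h y).
  have [n [x <-]] := colim_surj y.
  by rewrite -nmap_equivariant !hE nmap_equivariant.
exists (NMap ch hN); split=> // k kE y.
by have [n [x <-]] := colim_surj y; rewrite kE /= hE.
Qed.

End PushoutColimit.

(** * Balls, spheres and cylinders *)

Section EuclideanGeometry.
Variable R : realType.

Definition sqnorm n (v : 'rV[R]_n) : R := \sum_i v 0 i ^+ 2.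

Lemma sqnorm_ge0 n (v : 'rV[R]_n) : 0 <= sqnorm v.
Proof. by apply: sumr_ge0 => i _; exact: sqr_ge0. Qed.

Lemma sqnormZ n (k : R) (v : 'rV[R]_n) : sqnorm (k *: v) = k ^+ 2 * sqnorm v.
Proof. by rewrite /sqnorm mulr_sumr; apply: eq_bigr => i _; rewrite mxE exprMn. Qed.

Lemma sqnorm_row_mx n (x : R) (v : 'rV[R]_n) :
  sqnorm (row_mx x%:M v : 'rV_(1 + n)) = x ^+ 2 + sqnorm v.
Proof.
rewrite /sqnorm big_split_ord /= big_ord1 row_mxEl mxE eqxx mulr1n; congr (_ + _).
by apply: eq_bigr => i _; rewrite row_mxEr.
Qed.

Lemma row_mxS n (v : 'rV[R]_(1 + n)) : v = row_mx (v 0 0)%:M (rsubmx v).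
Proof.
rewrite -{1}(hsubmxK v); congr row_mx; apply/rowP => i.
rewrite !mxE ord1 eqxx mulr1n; congr (v _ _); exact: val_inj.
Qed.

Lemma sqnormS n (v : 'rV[R]_(1 + n)) : sqnorm v = v 0 0 ^+ 2 + sqnorm (rsubmx v).
Proof. by rewrite {1}(row_mxS v) sqnorm_row_mx. Qed.

Lemma coord_fun_continuous n (i : 'I_n) : continuous (fun v : 'rV[R]_n => v 0 i).
Proof. exact: coord_continuous. Qed.

Lemma row_continuous (X : topologicalType) n (f : X -> 'rV[R]_n) :
  (forall i, continuous (fun x => f x 0 i)) -> continuous f.
Proof.
move=> cf x U [P Px PU].
suff : \forall y \near x, forall i, P 0 i (f y 0 i).
  by apply: filterS => y Py; apply: PU => i j; rewrite (ord1 i).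
by apply: filter_forall => i; exact: (cf i x _ (Px 0 i)).
Qed.

Lemma sqnorm_continuous n : continuous (@sqnorm n).
Proof.
apply: fun_sum_continuous => i; apply: fun_expr_continuous.
exact: coord_fun_continuous.
Qed.

Lemma rsubmx_continuous n : continuous (rsubmx : 'rV[R]_(1 + n) -> 'rV[R]_n).
Proof.
apply: row_continuous => i.
rewrite (_ : (fun _ => _) = fun v : 'rV[R]_(1 + n) => v 0 (rshift 1 i)).
  exact: coord_fun_continuous.
by apply/funext => v; rewrite mxE.
Qed.

Lemma row_mx_continuous (X : topologicalType) n (f : X -> R) (g : X -> 'rV[R]_n) :
  continuous f -> continuous g ->
  continuous (fun x => row_mx (f x)%:M (g x) : 'rV[R]_(1 + n)).
Proof.
move=> cf cg; apply: row_continuous => i; case: (splitP i) => [j ij|j ij].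
  have -> : i = lshift n j by exact: val_inj.
  rewrite (_ : (fun _ => _) = f) //; apply/funext => x.
  by rewrite row_mxEl mxE ord1 eqxx.
have -> : i = rshift 1 j by exact: val_inj.
rewrite (_ : (fun _ => _) = fun x => g x 0 j).
  exact: (continuous_after cg (@coord_fun_continuous n j)).
by apply/funext => x; rewrite row_mxEr.
Qed.

Lemma scale_continuous (X : topologicalType) n (f : X -> R) (g : X -> 'rV[R]_n) :
  continuous f -> continuous g -> continuous (fun x => f x *: g x).
Proof.
move=> cf cg; apply: row_continuous => i.
rewrite (_ : (fun _ => _) = fun x => f x * g x 0 i).
  apply: fun_mulr_continuous => //.
  exact: (continuous_after cg (@coord_fun_continuous n i)).
by apply/funext => x; rewrite mxE.
Qed.

Lemma ballP n (v : @unit_ball R n) : sqnorm (set_val v) <= 1.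
Proof. exact: (set_valP v). Qed.

Lemma sphereP n (v : @unit_sphere R n) : sqnorm (set_val v) = 1.
Proof. exact: (set_valP v). Qed.

Definition ball_of n (v : 'rV[R]_n) (hv : sqnorm v <= 1) : @unit_ball R n :=
  @in_set_type _ (@unit_ball R n) v hv.
Definition sphere_of n (v : 'rV[R]_n) (hv : sqnorm v = 1) : @unit_sphere R n :=
  @in_set_type _ (@unit_sphere R n) v hv.

Lemma ball_ofE n (v : 'rV[R]_n) (hv : sqnorm v <= 1) : set_val (ball_of hv) = v.
Proof. exact: in_set_typeE. Qed.
Lemma sphere_ofE n (v : 'rV[R]_n) (hv : sqnorm v = 1) : set_val (sphere_of hv) = v.
Proof. exact: in_set_typeE. Qed.

Lemma to_ball_continuous (X : topologicalType) n (f : X -> 'rV[R]_n)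
    (hf : forall x, sqnorm (f x) <= 1) :
  continuous f -> continuous (fun x => ball_of (hf x)).
Proof.
by move=> cf; apply: continuous_to_set.
Qed.

Lemma to_sphere_continuous (X : topologicalType) n (f : X -> 'rV[R]_n)
    (hf : forall x, sqnorm (f x) = 1) :
  continuous f -> continuous (fun x => sphere_of (hf x)).
Proof.
by move=> cf; apply: continuous_to_set.
Qed.

Definition sphere_to_ball n (s : @unit_sphere R n) : @unit_ball R n :=
  subfun (@sphere_sub_ball R n) s.

Lemma sphere_to_ballE n (s : @unit_sphere R n) : set_val (sphere_to_ball s) = set_val s.
Proof. by rewrite !set_valE. Qed.

Section RadialExtension.
Variables (n : nat) (Z : topologicalType) (G : @unit_sphere R n -> R -> Z) (z0 : Z).
Hypotheses (cG : continuous (fun z : @unit_sphere R n * R => G z.1 z.2))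
           (G1 : forall s t, 1 <= t -> G s t = z0).

(** A homotopy of a map of the sphere that ends at the constant [z0] is a map of the
    ball: the radius [k] is the time [2 * (1 - k)]. Ending at radius one
    half rather than at the centre keeps the formula away from the point where
    the direction of a vector is undefined. *)
Lemma radial_extension : exists U : 'rV[R]_n -> Z,
  [/\ continuous U, forall v, sqnorm v <= 4^-1 -> U v = z0 &
      forall s k, 2^-1 <= k -> U (k *: set_val s) = G s (2 * (1 - k))].
Proof.
pose norm (v : 'rV[R]_n) := Num.sqrt (sqnorm v).
have cnorm : continuous norm.
  by apply: fun_sqrtr_continuous; exact: sqnorm_continuous.
pose far := [set v : 'rV[R]_n | 2^-1 - norm v <= 0].
pose near := [set v : 'rV[R]_n | 0 <= 2^-1 - norm v].
have cdiff : continuous (fun v => 2^-1 - norm v) by cont.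
have far_ge (v : far) : 2^-1 <= norm (set_val v).
  by have := set_valP v; rewrite /far /= subr_le0.
have far_gt0 (v : far) : 0 < norm (set_val v).
  by apply: lt_le_trans (far_ge v); rewrite invr_gt0.
have far_sphere (v : far) : sqnorm ((norm (set_val v))^-1 *: set_val v) = 1.
  rewrite sqnormZ exprVn sqr_sqrtr ?sqnorm_ge0 // mulVf //.
  by have := far_gt0 v; rewrite sqrtr_gt0 => /lt0r_neq0.
have [||v|||v w vw|U [cU U1 U0]] := @paste _ Z far near
  (fun v => G (sphere_of (far_sphere v)) (2 * (1 - norm (set_val v)))) (fun _ => z0).
- exact: closed_le0.
- exact: closed_ge0.
- by rewrite /far /near /=; case: (leP (2^-1 - norm v) 0) => [|/ltW]; [left|right].
- have cv : continuous (fun v : far => norm (set_val v)).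
    exact: (continuous_after (@set_val_continuous _ far) cnorm).
  apply: (@continuous_after _ _ _
    (fun v => (sphere_of (far_sphere v), 2 * (1 - norm (set_val v)))) _ _ cG).
  apply: fun_pair_continuous; last by cont.
  apply: to_sphere_continuous; apply: scale_continuous; last by cont.
  by apply: fun_invr_continuous => // v; rewrite gt_eqF.
- exact: fun_cst_continuous.
- have nw : near (set_val w) := set_valP w.
  move: nw; rewrite -vw /near /= => nw; apply: G1; lra.
exists U; split=> // [v v0|s k k2].
  have nv : near v.
    have half0 : 0 <= 2^-1 :> R by rewrite invr_ge0.
    rewrite /near /= subr_ge0 /norm -[leRHS](ger0_norm half0) -sqrtr_sqr.
    by rewrite ler_wsqrtr // (le_trans v0) // expr2 -invfM -natrM.
  by rewrite -(in_set_typeE nv) U0.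
have k0 : 0 < k by apply: lt_le_trans k2; rewrite invr_gt0.
have ks : norm (k *: set_val s) = k.
  by rewrite /norm sqnormZ sphereP mulr1 sqrtr_sqr gtr0_norm.
have fv : far (k *: set_val s) by rewrite /far /= ks subr_le0.
rewrite -(in_set_typeE fv) U1; congr (G _ _); last by rewrite in_set_typeE ks.
apply: set_val_inj; rewrite sphere_ofE in_set_typeE ks scalerA mulVf ?scale1r //.
by rewrite gt_eqF.
Qed.

End RadialExtension.

Section CylinderFilling.
Variable n : nat.

(** The map [cyl] from the cylinder on the [n]-ball to the [n.+1]-ball sends the
    bottom of the cylinder onto the lower hemisphere by vertical projection, and
    the side and the top into the upper hemisphere: the side fills the part above
    the vectors of norm at least one half, and the top the remaining cap. With
    [r] the height of the upper hemisphere over [cyl_rad v t], the height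
    runs from [- r] at the bottom to [r] on the side and the top; the subtracted
    term is [2 * r] at the bottom, vanishes on the side and on the top, and is at
    most [2 * r] throughout. *)
Definition cyl_rad (v : @unit_ball R n) (t : R) : 'rV[R]_n :=
  (1 - clamp t / 2) *: set_val v.
Definition cyl_height (v : @unit_ball R n) (t : R) : R :=
  Num.sqrt (1 - sqnorm (cyl_rad v t))
  - 2 * (1 - clamp t) * Num.sqrt (1 - sqnorm (set_val v)).
Definition cyl_row (v : @unit_ball R n) (t : R) : 'rV[R]_(1 + n) :=
  row_mx (cyl_height v t)%:M (cyl_rad v t).

Lemma cyl_rad_le v t : sqnorm (cyl_rad v t) <= sqnorm (set_val v).
Proof.
have /andP[t0 t1] := clamp_itv t.
rewrite sqnormZ ler_piMl ?sqnorm_ge0 // expr_le1 //; lra.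
Qed.

Lemma cyl_rad_le1 v t : sqnorm (cyl_rad v t) <= 1.
Proof. exact: le_trans (cyl_rad_le v t) (ballP v). Qed.

Lemma cyl_row_ball v t : sqnorm (cyl_row v t) <= 1.
Proof.
rewrite /cyl_row sqnorm_row_mx.
have /andP[t0 t1] := clamp_itv t.
have le1 := cyl_rad_le1 v t.
set r := Num.sqrt (1 - sqnorm (cyl_rad v t)).
have r0 : 0 <= r by exact: sqrtr_ge0.
have rr : r ^+ 2 = 1 - sqnorm (cyl_rad v t) by rewrite sqr_sqrtr ?subr_ge0.
set w := Num.sqrt (1 - sqnorm (set_val v)).
have w0 : 0 <= w by exact: sqrtr_ge0.
have wr : w <= r by rewrite ler_wsqrtr // lerD2l lerN2 cyl_rad_le.
rewrite -lerBrDr -rr /cyl_height -/r -/w.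
set g := (1 - clamp t) * w.
have g0 : 0 <= g by rewrite mulr_ge0 // subr_ge0.
have gr : g <= r by apply: le_trans wr; rewrite ler_piMl // gerBl.
rewrite -mulrA -/g; nra.
Qed.

Definition cyl v t : @unit_ball R (1 + n) := ball_of (cyl_row_ball v t).

Lemma cyl_continuous : continuous (fun z : @unit_ball R n * R => cyl z.1 z.2).
Proof.
have cv : continuous (fun z : @unit_ball R n * R => set_val z.1).
  exact: (continuous_after (@fst_continuous _ _) (@set_val_continuous _ _)).
have cr : continuous (fun z : @unit_ball R n * R => cyl_rad z.1 z.2).
  by apply: scale_continuous => //; cont.
apply: to_ball_continuous; apply: row_mx_continuous => //.
have ch : continuous (fun z : @unit_ball R n * R => sqnorm (cyl_rad z.1 z.2)).
  exact: (continuous_after cr (@sqnorm_continuous n)).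
have cw : continuous (fun z : @unit_ball R n * R => sqnorm (set_val z.1)).
  exact: (continuous_after cv (@sqnorm_continuous n)).
rewrite /cyl_height; cont.
Qed.

Section Filling.
Variables (Z : topologicalType) (c : @unit_ball R n -> Z)
  (G : @unit_sphere R n -> R -> Z) (z0 : Z).
Hypotheses (cc : continuous c)
  (cG : continuous (fun z : @unit_sphere R n * R => G z.1 z.2))
  (G0 : forall s t, t <= 0 -> G s t = c (sphere_to_ball s))
  (G1 : forall s t, 1 <= t -> G s t = z0).

Lemma sphere_tail_le1 (u : @unit_sphere R (1 + n)) : sqnorm (rsubmx (set_val u)) <= 1.
Proof. have := sphereP u; rewrite sqnormS; have := sqr_ge0 (set_val u 0 0); lra. Qed.

(** A map on the boundary of the cylinder, equal to [c] on the bottom, to [G] on the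
    side and constant on the top, factors through [cyl] by a map [f] of the sphere.
    It is [c] on the lower hemisphere and, over the upper one, the radial
    extension of [G]. A map that extends [f] to the ball thus fills the
    cylinder. The predicate [P] in the last clause records that [f] takes only
    values of the three given maps. *)
Lemma cylinder_boundary_map : exists f : @unit_sphere R (1 + n) -> Z,
  [/\ continuous f,
    forall v t, t <= 0 -> exists2 u, set_val u = set_val (cyl v t) & f u = c v,
    forall v t, 1 <= t -> exists2 u, set_val u = set_val (cyl v t) & f u = z0,
    forall s t, exists2 u, set_val u = set_val (cyl (sphere_to_ball s) t) & f u = G s t
    & forall P : Z -> Prop, (forall v, P (c v)) -> (forall s t, P (G s t)) -> P z0 ->
        forall u, P (f u)].
Proof.
have [U [cU U0 UG]] := radial_extension cG G1.
have cx : continuous (fun u : @unit_sphere R (1 + n) => set_val u 0 0).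
  exact: (continuous_after (@set_val_continuous _ _) (@coord_fun_continuous (1 + n) 0)).
have crs : continuous (fun u : @unit_sphere R (1 + n) => rsubmx (set_val u)).
  exact: (continuous_after (@set_val_continuous _ _) (@rsubmx_continuous n)).
pose f (u : @unit_sphere R (1 + n)) :=
  if set_val u 0 0 <= 0 then c (ball_of (sphere_tail_le1 u))
  else U (rsubmx (set_val u)).
have UE (s : @unit_sphere R n) : U (set_val s) = c (sphere_to_ball s).
  by rewrite -[set_val s]scale1r UG ?subrr ?mulr0 ?G0 // invf_le1 // ler1n.
have fU (u : @unit_sphere R (1 + n)) :
    0 <= set_val u 0 0 -> f u = U (rsubmx (set_val u)).
  rewrite /f => u0; case: ifPn => // u0'.
  have {}u0 : set_val u 0 0 = 0 by apply/le_anti/andP.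
  have hs : sqnorm (rsubmx (set_val u)) = 1.
    by have := sphereP u; rewrite sqnormS u0 expr0n add0r.
  rewrite -[in RHS](sphere_ofE hs) UE; congr c; apply: set_val_inj.
  by rewrite sphere_to_ballE sphere_ofE ball_ofE.
have fc (u : @unit_sphere R (1 + n)) (v : @unit_ball R n) :
    set_val u 0 0 <= 0 -> rsubmx (set_val u) = set_val v -> f u = c v.
  move=> u0 uv; rewrite /f u0; congr c; apply: set_val_inj.
  by rewrite ball_ofE.
have coordE (h : R) (v : 'rV[R]_n) : (row_mx h%:M v : 'rV_(1 + n)) 0 0 = h.
  have -> : 0 = lshift n 0 :> 'I_(1 + n) by exact: val_inj.
  by rewrite row_mxEl mxE eqxx.
have fZ (u : @unit_sphere R (1 + n)) (h : R) (v : 'rV[R]_n) :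
    set_val u = row_mx h%:M v -> 0 <= h -> f u = U v.
  by move=> uE h0; rewrite fU uE ?coordE // row_mxKr.
exists f; split.
- apply: if_continuous => //; first exact: fun_cst_continuous.
  + apply: (@continuous_after _ _ _ (fun x => ball_of (sphere_tail_le1 x)) c) => //.
    exact: to_ball_continuous.
  + exact: (continuous_after crs cU).
  + by move=> u u0; rewrite -fU ?u0 // /f u0 lexx.
- move=> v t t0.
  have rE : cyl_rad v t = set_val v.
    by rewrite /cyl_rad clamp_le0 // mul0r subr0 scale1r.
  have hE : cyl_height v t = - Num.sqrt (1 - sqnorm (set_val v)).
    rewrite /cyl_height rE clamp_le0 //; ring.
  have hs : sqnorm (cyl_row v t) = 1.
    rewrite sqnorm_row_mx rE hE sqrrN sqr_sqrtr ?subr_ge0 ?ballP //; ring.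
  exists (sphere_of hs); first by rewrite sphere_ofE ball_ofE.
  apply: fc; rewrite sphere_ofE ?row_mxKr // coordE hE oppr_le0.
  exact: sqrtr_ge0.
- move=> v t t1.
  have rE : cyl_rad v t = 2^-1 *: set_val v.
    rewrite /cyl_rad clamp_ge1 //; congr (_ *: _); lra.
  have hE : cyl_height v t = Num.sqrt (1 - sqnorm (cyl_rad v t)).
    rewrite /cyl_height clamp_ge1 //; ring.
  have hs : sqnorm (cyl_row v t) = 1.
    rewrite sqnorm_row_mx hE sqr_sqrtr ?subr_ge0 ?cyl_rad_le1 //; ring.
  exists (sphere_of hs); first by rewrite sphere_ofE ball_ofE.
  rewrite (fZ _ _ _ (sphere_ofE hs)) ?hE ?sqrtr_ge0 // U0 // rE sqnormZ.
  have := ballP v; have := sqnorm_ge0 (set_val v); nra.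
- move=> s t; set v := sphere_to_ball s.
  have vE : set_val v = set_val s by exact: sphere_to_ballE.
  have hE : cyl_height v t = Num.sqrt (1 - sqnorm (cyl_rad v t)).
    have wE : Num.sqrt (1 - sqnorm (set_val v)) = 0.
      by rewrite vE sphereP subrr sqrtr0.
    by rewrite /cyl_height wE mulr0 subr0.
  have hs : sqnorm (cyl_row v t) = 1.
    rewrite sqnorm_row_mx hE sqr_sqrtr ?subr_ge0 ?cyl_rad_le1 //; ring.
  exists (sphere_of hs); first by rewrite sphere_ofE ball_ofE.
  rewrite (fZ _ _ _ (sphere_ofE hs)) ?hE ?sqrtr_ge0 // /cyl_rad vE UG; last first.
    by have /andP[] := clamp_itv t; lra.
  (* The radius 1 - clamp t / 2 corresponds to the time clamp t. *)
  rewrite (_ : 2 * _ = clamp t); last by field.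
  have [t0|t0] := leP t 0; first by rewrite clamp_le0 // !G0.
  have [t1|t1] := leP 1 t; first by rewrite clamp_ge1 // !G1.
  by rewrite clamp_id // (ltW t0) (ltW t1).
- move=> P Pc PG P0 u; rewrite /f; case: ifPn => // _.
  set v := rsubmx _; have v1 := sphere_tail_le1 u; rewrite -/v in v1.
  have [v4|v4] := leP (sqnorm v) 4^-1; first by rewrite U0.
  have v0 : 0 < sqnorm v by apply: lt_trans v4; rewrite invr_gt0.
  pose k := Num.sqrt (sqnorm v).
  have k0 : 0 < k by rewrite sqrtr_gt0.
  have kk : k ^+ 2 = sqnorm v by rewrite sqr_sqrtr ?sqnorm_ge0.
  have hs : sqnorm (k^-1 *: v) = 1 by rewrite sqnormZ exprVn kk mulVf ?gt_eqF.
  have -> : v = k *: set_val (sphere_of hs).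
    by rewrite sphere_ofE scalerA divff ?gt_eqF // scale1r.
  rewrite UG //; nra.
Qed.

End Filling.
End CylinderFilling.
End EuclideanGeometry.

(** * Free cells and attachments over a discrete N-set *)

Section FreeNset.
Variables (N : monoidType) (J : choiceType).

Definition free_act (a : N) (p : N * J) : N * J := ((a * p.1)%g, p.2).

Lemma free_actP : is_action free_act.
Proof. by split=> [[b j]|a b [c j]]; rewrite /free_act /= ?mul1g ?mulgA. Qed.

Definition free_nset : nset N := NSet free_actP.

Lemma free_projective : projective free_nset.
Proof.
move=> Q f fN fsurj; have [q qE] := choice (fun j => fsurj (1%g, j)).
exists (fun p => sact p.1 (q p.2)); split=> [a [b j]|[b j]] /=.
  by rewrite (sactP Q).2.
by rewrite fN qE /= /free_act /= mulg1.
Qed.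

End FreeNset.

Lemma free_fin_gen (N : monoidType) (J : finType) : fin_gen (free_nset N J).
Proof.
exists [seq (1%g, j) | j <- enum J] => -[b j]; exists b, (1%g, j); split.
  by apply/mapP; exists j; rewrite ?mem_enum.
by rewrite /= /free_act /= mulg1.
Qed.

Section Stages.
Variables (R : realType) (N : monoidType) (D : nset N).

(** The map to the discrete N-set [D] labels the path components; once the
    space is contractible over [D] it identifies them with [D]. *)
Record stage := Stage {
  st_space :> nspace N;
  st_deg : nmap st_space (disc_nspace D) }.

Definition deg (S : stage) (x : S) : D := st_deg S x.

Lemma deg_act (S : stage) a (x : S) : deg (nact a x) = sact a (deg x).
Proof. exact: (nmap_equivariant (st_deg S)). Qed.

Lemma deg_path (S : stage) (x y : S) : path_connected_to R x y -> deg x = deg y.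
Proof.
move=> [g [cg <- <-]]; apply: (@discrete_path_constant R D (fun t => deg (g t))).
move=> t; apply: (@continuous_comp (subspace _) S (disc_nspace D) g (st_deg S)).
  exact: cg.
exact: nmap_continuous.
Qed.

Lemma deg_continuous_path (S : stage) (g : R -> S) s t :
  continuous g -> deg (g s) = deg (g t).
Proof.
move=> cg; apply: deg_path; exists (fun r => g (t * r + s * (1 - r))); split.
- apply: continuous_subspaceT.
  by apply: (@continuous_after _ _ _ (fun r => t * r + s * (1 - r)) g) => //; cont.
- by congr g; ring.
- by congr g; ring.
Qed.

(** The label is part of the data so that spheres of every dimension can be treated
    alike: it is what allows the map to [D] to be extended over an attached cell,
    and a map of the 0-sphere need not have constant degree. *)
Record sphere_map (S : stage) (n : nat) := SphereMap {
  sm_fun :> @unit_sphere R n -> S;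
  sm_continuous : continuous sm_fun;
  sm_lab : D;
  sm_deg : forall s, deg (sm_fun s) = sm_lab }.

Record attaching (S : stage) (n : nat) := Attaching {
  att_idx : choiceType;
  att_map : att_idx -> sphere_map S n }.

Section AttachMap.
Variables (S : stage) (n : nat) (a : attaching S n).

Definition cells := free_nset N (att_idx a).

Definition attach_fun (z : cells_sphere R cells n) : S :=
  nact (z.1 : cells).1 (att_map (z.1 : cells).2 z.2).

Lemma attach_continuous : continuous attach_fun.
Proof.
apply: (@discrete_prod_continuous cells _ S
  (fun (p : cells) s => nact p.1 (att_map p.2 s))) => p.
apply: continuous_after; first exact: sm_continuous.
exact: nact_continuous1.
Qed.

Lemma attach_equivariant b z : attach_fun (nact b z) = nact b (attach_fun z).
Proof. by case: z => -[c j] s; rewrite /attach_fun /= (nactP S).2. Qed.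

Definition attach_nmap : nmap (cells_sphere R cells n) S :=
  NMap attach_continuous attach_equivariant.

End AttachMap.

(** What is needed of the space obtained from [S] by attaching the free cells
    [N * att_idx a] along the translates of the maps [att_map]. *)
Record attachment (S : stage) (n : nat) (a : attaching S n) := Attachment {
  at_stage : stage;
  at_incl : nmap S at_stage;
  at_cells : nmap (cells_ball R (cells a) n) at_stage;
  at_pushout : is_pushout (attach_nmap a) (cells_incl R (cells a) n) at_incl at_cells;
  at_surj : forall y, (exists x, at_incl x = y) \/ (exists c, at_cells c = y);
  at_lift : forall (Z : topologicalType) (u : S -> Z)
      (v : N -> att_idx a -> @unit_ball R n -> Z),
    continuous u -> (forall b j, continuous (v b j)) ->
    (forall b j s, u (nact b (att_map j s)) = v b j (sphere_to_ball s)) ->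
    exists h : at_stage -> Z, [/\ continuous h, forall x, h (at_incl x) = u x &
      forall b j z, h (at_cells ((b, j), z)) = v b j z];
  at_deg_incl : forall x, deg (at_incl x) = deg x;
  at_deg_cells : forall b j z,
    deg (at_cells ((b, j), z)) = sact b (sm_lab (att_map j)) }.

Lemma attach (S : stage) (n : nat) (a : attaching S n) : attachment a.
Proof.
have X := nspace_pushout (attach_nmap a) (cells_incl R (cells a) n).
have lab_glue z : st_deg S (attach_nmap a z) =
    sact (z.1 : cells a).1 (sm_lab (att_map (z.1 : cells a).2)).
  case: z => -[b j] s; rewrite /= /attach_fun /=.
  by rewrite -(sm_deg (att_map j) s); exact: deg_act.
have clab : continuous (fun z : cells_ball R (cells a) n =>
    sact (z.1 : cells a).1 (sm_lab (att_map (z.1 : cells a).2)) : disc_nspace D).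
  apply: (@discrete_prod_continuous (cells a) _ (disc_nspace D) (fun p _ =>
    sact p.1 (sm_lab (att_map p.2)))) => p.
  exact: fun_cst_continuous.
have labN b (z : cells_ball R (cells a) n) :
    sact ((nact b z).1 : cells a).1 (sm_lab (att_map ((nact b z).1 : cells a).2)) =
    nact b (sact (z.1 : cells a).1 (sm_lab (att_map (z.1 : cells a).2))
            : disc_nspace D).
  by rewrite /= (sactP D).2.
pose lab : nmap (cells_ball R (cells a) n) (disc_nspace D) := NMap clab labN.
have [d [dl dr _]] := cid ((pushout_nspaceP X).2 _ (st_deg S) lab lab_glue).
apply: (@Attachment S n a (Stage d) (po_inl X) (po_inr X)).
- exact: pushout_nspaceP.
- exact: po_surj.
- move=> Z u v cu cv uv.
  have [||h [ch hu hv]] := po_lift X (Z := Z) (u := u)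
    (v := fun z => v (z.1 : cells a).1 (z.1 : cells a).2 z.2) cu.
  + exact: (@discrete_prod_continuous (cells a) _ Z (fun p => v p.1 p.2)).
  + by move=> [[b j] s]; rewrite /= /attach_fun /= uv.
  by exists h; split=> // b j z; rewrite hv.
- exact: dl.
- by move=> b j z; exact: dr.
Qed.

Section AttachmentTheory.
Variables (S : stage) (n : nat) (a : attaching S n) (A : attachment a).

Definition at_char (b : N) (j : att_idx a) (z : @unit_ball R n) : at_stage A :=
  at_cells A ((b, j), z).

Lemma at_char_continuous b j : continuous (at_char b j).
Proof.
apply: (@continuous_after _ (cells_ball R (cells a) n) _ (fun z => ((b, j), z))).
  by apply: fun_pair_continuous; cont.
exact: nmap_continuous.
Qed.

Lemma at_char_sphere b j s :
  at_char b j (sphere_to_ball s) = at_incl A (nact b (att_map j s)).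
Proof. exact: esym ((at_pushout A).1 ((b, j), s)). Qed.

Lemma at_char_act c b j z : nact c (at_char b j z) = at_char (c * b)%g j z.
Proof. by rewrite /at_char -nmap_equivariant. Qed.

(** Homotopies may be defined cell by cell: they are maps into a space of paths, to
    which the universal property of the attachment applies. *)
Lemma at_lift_homotopy (Z : topologicalType) (u : S -> R -> Z)
    (v : N -> att_idx a -> @unit_ball R n -> R -> Z) :
  continuous (fun z : S * R => u z.1 z.2) ->
  (forall b j, continuous (fun z : @unit_ball R n * R => v b j z.1 z.2)) ->
  (forall b j s t, u (nact b (att_map j s)) t = v b j (sphere_to_ball s) t) ->
  exists h : at_stage A -> R -> Z,
    [/\ continuous (fun z : at_stage A * R => h z.1 z.2),
      forall x t, h (at_incl A x) t = u x t &
      forall b j z t, h (at_char b j z) t = v b j z t].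
Proof.
move=> cu cv uv.
have [|||h [ch hu hv]] := at_lift A (Z := {compact-open, R -> Z}) (u := u) (v := v).
- exact: curry_path_continuous.
- by move=> b j; exact: curry_path_continuous.
- by move=> b j s; apply/funext => t; exact: uv.
have hvE b j z : h (at_char b j z) = v b j z by exact: hv.
exists h; split=> [|x t|b j z t]; rewrite ?hu ?hvE //.
apply: uncurry_path_continuous => // y.
have [[x <-]|[[[b j] z] <-]] := at_surj y.
  by rewrite hu; exact: continuous_section.
by rewrite -/(at_char b j z) hvE; exact: continuous_section.
Qed.

End AttachmentTheory.

Definition all_spheres (S : stage) (n : nat) : attaching S n :=
  @Attaching S n {classic (sphere_map S n)} id.

(** The homotopy takes place in a larger stage [S'], because contracting an
    [n]-dimensional skeleton needs cells of dimension [n.+1]. *)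
Record contracting_homotopy (S S' : stage) (i : nmap S S') (o : D -> S')
  (H : S -> R -> S') : Prop := Contraction {
  ctr_continuous : continuous (fun z : S * R => H z.1 z.2);
  ctr_start : forall x t, t <= 0 -> H x t = i x;
  ctr_end : forall x t, 1 <= t -> H x t = o (deg x) }.

Lemma contraction_deg (S S' : stage) (i : nmap S S') (o : D -> S') (H : S -> R -> S') :
  (forall x, deg (i x) = deg x) -> contracting_homotopy i o H ->
  forall x t, deg (H x t) = deg x.
Proof.
move=> degi [cH H0 _] x t; rewrite -degi -(H0 x 0) //; apply: deg_continuous_path.
exact: continuous_section cH.
Qed.

Section ExtendContraction.
Variables (S : stage) (n : nat) (a : attaching S n) (A : attachment a).
Variables (S' : stage) (i : nmap (at_stage A) S') (o : D -> at_stage A).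
Variable H : S -> R -> at_stage A.
Hypothesis ctrH : contracting_homotopy (at_incl A) o H.

(** The cylinder on a cell can be filled in [S'], given the cell at the bottom, the
    homotopy [H] of its attaching map on the side, and the base point on top. *)
Definition fillable (b : N) (j : att_idx a) : Prop :=
  exists h : @unit_ball R n -> R -> S',
  [/\ continuous (fun z : @unit_ball R n * R => h z.1 z.2),
    forall s t, h (sphere_to_ball s) t = i (H (nact b (att_map j s)) t),
    forall z t, t <= 0 -> h z t = i (at_char A b j z) &
    forall z t, 1 <= t -> h z t = i (o (sact b (sm_lab (att_map j))))].

Lemma extend_contraction : (forall b j, fillable b j) ->
  exists H' : at_stage A -> R -> S',
    contracting_homotopy i (fun d => i (o d)) H' /\
    forall x t, H' (at_incl A x) t = i (H x t).
Proof.
move=> fill; have [cH H0 H1] := ctrH.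
have [h hP] := choice (fun p : N * att_idx a => fill p.1 p.2).
have [||b j s t|H' [cH' H'incl H'char]] := at_lift_homotopy A
    (u := fun x t => i (H x t)) (v := fun b j => h (b, j)).
- by apply: (continuous_after cH); exact: nmap_continuous.
- by move=> b j; have [] := hP (b, j).
- by have [_ ->] := hP (b, j).
exists H'; split=> //; split=> // [y t t0|y t t1];
  have [[x <-]|[[[b j] z] <-]] := at_surj y; rewrite -?/(at_char A b j z).
- by rewrite H'incl H0.
- by rewrite H'char; have [_ _ ->] := hP (b, j).
- by rewrite H'incl H1 // at_deg_incl.
- by rewrite H'char at_deg_cells; have [_ _ _ ->] := hP (b, j).
Qed.

End ExtendContraction.

(** The boundary of the cylinder on a cell is a sphere in [at_stage A], hence one of
    the attaching maps of the next stage, whose cell fills the cylinder. *)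
Lemma all_spheres_fillable (S : stage) (n : nat) (a : attaching S n)
    (A : attachment a) (A' : attachment (all_spheres (at_stage A) n.+1))
    (o : D -> at_stage A) (H : S -> R -> at_stage A) :
  (forall d, deg (o d) = d) -> contracting_homotopy (at_incl A) o H ->
  forall b j, fillable (at_incl A') o H b j.
Proof.
move=> dego ctrH b j; have [cH H0 H1] := ctrH.
pose c := at_char A b j; pose d := sact b (sm_lab (att_map j)).
pose G s t := H (nact b (att_map j s)) t.
have dG s t : deg (G s t) = d.
  by rewrite /G (contraction_deg (@at_deg_incl _ _ _ A) ctrH) deg_act sm_deg.
have [||s t t0|s t t1|f [cf f0 f1 fG fP]] :=
    cylinder_boundary_map (c := c) (G := G) (z0 := o d).
- exact: at_char_continuous.
- apply: (@continuous_after _ _ _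
    (fun z : @unit_sphere R n * R => (nact b (att_map j z.1), z.2)) _ _ cH).
  apply: fun_pair_continuous; last by cont.
  apply: (@continuous_after _ _ _ (fun z : @unit_sphere R n * R => att_map j z.1)).
    apply: (@continuous_after _ _ _ fst); [by cont|exact: sm_continuous].
  exact: nact_continuous1.
- by rewrite /G H0 // /c at_char_sphere.
- by rewrite /G H1 // deg_act sm_deg.
have df u : deg (f u) = d.
  by apply: (fP (fun z => deg z = d)) => [v|//|]; [exact: at_deg_cells|exact: dego].
pose k : att_idx (all_spheres (at_stage A) n.+1) := SphereMap cf df.
have charE u z : set_val u = set_val z -> at_char A' 1%g k z = at_incl A' (f u).
  move=> uz; rewrite (_ : z = sphere_to_ball u).
    by rewrite at_char_sphere (nactP _).1.
  by apply: set_val_inj; rewrite sphere_to_ballE.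
exists (fun z t => at_char A' 1%g k (cyl z t)); split.
- apply: (@continuous_after _ _ _ (fun z : @unit_ball R n * R => cyl z.1 z.2)).
    exact: cyl_continuous.
  exact: at_char_continuous.
- by move=> s t; rewrite -/(G s t); have [u uE <-] := fG s t; rewrite (charE u).
- by move=> z t t0; rewrite -/(c z); have [u uE <-] := f0 z t t0; rewrite (charE u).
- by move=> z t t1; rewrite -/d; have [u uE <-] := f1 z t t1; rewrite (charE u).
Qed.

End Stages.

(** * Homotopies of paths of varying length *)

Section PathHomotopy.
Variables (R : realType) (Z : topologicalType).
Implicit Types p q : R -> Z.

(** Paths are parametrized by the whole line and stand still outside [0, L]. With
    lengths, concatenation is strictly associative and the path of a product of
    words is literally the concatenation of translates of their paths. *)
Record is_path (L : R) p : Prop := IsPath {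
  path_len : 0 <= L;
  path_continuous : continuous p;
  path_before : forall s, s <= 0 -> p s = p 0;
  path_after : forall s, L <= s -> p s = p L }.

Definition concat (L : R) p q : R -> Z := fun s => if s <= L then p s else q (s - L).

Lemma concat_left L p q s : s <= L -> concat L p q s = p s.
Proof. by rewrite /concat => ->. Qed.

Lemma concat_right L p q s : p L = q 0 -> L <= s -> concat L p q s = q (s - L).
Proof.
rewrite /concat => pq; case: ifPn => // sL Ls.
by have -> : s = L by [apply/le_anti/andP]; rewrite subrr.
Qed.

Lemma is_path_concat L L' p q : is_path L p -> is_path L' q -> p L = q 0 ->
  is_path (L + L') (concat L p q).
Proof.
move=> [L0 cp p0 p1] [L'0 cq q0 q1] pq; split.
- exact: addr_ge0.
- apply: if_continuous => //; [by cont|by cont| |by move=> s ->; rewrite subrr].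
  by apply: (@continuous_after _ _ _ (fun s => s - L) q) => //; cont.
- by move=> s s0; rewrite !concat_left ?p0 // (le_trans s0).
- move=> s s1; rewrite !concat_right //; [|lra|lra].
  by rewrite q1 ?[in RHS]q1 //; lra.
Qed.

Lemma concatA L L' p q r : 0 <= L' -> 
  concat L p (concat L' q r) = concat (L + L') (concat L p q) r.
Proof.
move=> L'0; apply/funext => s; rewrite /concat lerBlDl opprD addrA.
by case: (leP s L) => // sL; rewrite (le_trans sL) // lerDl.
Qed.

(** The homotopy fixes the end points outside [0, L], where [L] may exceed the
    lengths of both paths; paths of different lengths can thus be homotopic. *)
Record htp_at (L : R) p q (K : R -> R -> Z) : Prop := HtpAt {
  htp_len : 0 <= L;
  htp_continuous : continuous (fun z : R * R => K z.1 z.2);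
  htp_left : forall s, K s 0 = p s;
  htp_right : forall s, K s 1 = q s;
  htp_before : forall s t, s <= 0 -> K s t = p 0;
  htp_after : forall s t, L <= s -> K s t = p L }.

Definition htp p q : Prop := exists L K, htp_at L p q K.

Lemma htp_at_widen L L' p q K : L <= L' -> htp_at L p q K -> htp_at L' p q K.
Proof.
move=> LL' [L0 cK K0 K1 Kb Ka]; split=> // [|s t L's]; first exact: le_trans LL'.
by rewrite Ka ?(le_trans LL') // -[RHS]K0 Ka.
Qed.

Lemma htp_refl L p : is_path L p -> htp p p.
Proof.
move=> [L0 cp p0 p1]; exists L, (fun s _ => p s); split=> // [|s t /p0|s t /p1] //.
by apply: (@continuous_after _ _ _ fst p) => //; cont.
Qed.

Lemma htp_at_ends L p q K : htp_at L p q K -> p 0 = q 0 /\ p L = q L.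
Proof. by move=> [L0 _ _ K1 Kb Ka]; rewrite -!K1 Kb // Ka. Qed.

Lemma htp_sym p q : htp p q -> htp q p.
Proof.
move=> [L [K hK]]; have [e0 eL] := htp_at_ends hK; have [L0 cK K0 K1 Kb Ka] := hK.
exists L, (fun s t => K s (1 - t)); split=> [//||s|s|s t s0|s t sL].
- by apply: (@continuous_after _ _ _ (fun z : R * R => (z.1, 1 - z.2)) _ _ cK); cont.
- by rewrite subr0.
- by rewrite subrr.
- by rewrite Kb.
- by rewrite Ka.
Qed.

Lemma htp_trans p q r : htp p q -> htp q r -> htp p r.
Proof.
move=> [L1 [K hK]] [L2 [K' hK']]; pose L := Num.max L1 L2.
have {}hK : htp_at L p q K by apply: htp_at_widen hK; rewrite le_max lexx.
have {}hK' : htp_at L q r K' by apply: htp_at_widen hK'; rewrite le_max lexx orbT.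
have [e0 eL] := htp_at_ends hK; have [L0 cK K0 K1 Kb Ka] := hK.
have [_ cK' K'0 K'1 K'b K'a] := hK'.
exists L, (fun s t => if 2 * t <= 1 then K s (2 * t) else K' s (2 * t - 1)).
split=> [//||s|s|s t s0|s t sL].
- apply: if_continuous; [by cont|by cont| | |].
  + by apply: (@continuous_after _ _ _ (fun z : R * R => (z.1, 2 * z.2)) _ _ cK); cont.
  + apply: (@continuous_after _ _ _ (fun z : R * R => (z.1, 2 * z.2 - 1)) _ _ cK').
    by cont.
  + by move=> z ->; rewrite subrr K1 K'0.
- by rewrite mulr0 ler01 K0.
- rewrite mulr1 ifF; last by apply/negbTE; rewrite -ltNge ltr1n.
  by rewrite (_ : 2 - 1 = 1) ?K'1 //; ring.
- by case: ifP => _; rewrite ?Kb ?K'b.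
- by case: ifP => _; rewrite ?Ka ?K'a.
Qed.

Lemma htp_concat L p q p' q' K K' :
  htp_at L p q K -> htp_at L p' q' K' -> p L = p' 0 ->
  htp (concat L p p') (concat L q q').
Proof.
move=> [L0 cK K0 K1 Kb Ka] [_ cK' K'0 K'1 K'b K'a] pp'.
exists (L + L), (fun s t => if s <= L then K s t else K' (s - L) t).
split=> [||s|s|s t s0|s t sL].
- exact: addr_ge0.
- apply: if_continuous => //; [by cont|by cont| |].
  + by apply: (@continuous_after _ _ _ (fun z : R * R => (z.1 - L, z.2)) _ _ cK'); cont.
  + by move=> z zL; rewrite zL subrr Ka // K'b.
- by rewrite K0 K'0.
- by rewrite K1 K'1.
- by rewrite (le_trans s0 L0) Kb // concat_left.
- rewrite concat_right //; last by rewrite lerDl.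
  have [sL'|sL'] := leP s L.
    have L00 : L = 0 by lra.
    rewrite Ka; last by rewrite (le_trans _ sL) // lerDl.
    by rewrite pp' addrK L00.
  rewrite K'a ?lerBrDr // addrK //.
Qed.

(** Waiting at the end of [p] does not change the homotopy class of the
    concatenation; this is what reconciles concatenations at different lengths. *)
Lemma htp_pause l L p q L' :
  is_path l p -> is_path L' q -> p l = q 0 -> l <= L ->
  htp (concat l p q) (concat L p q).
Proof.
move=> [l0 cp p0 p1] [L'0 cq q0 q1] pq lL.
(* The second path starts at the time l + t (L - l). *)
pose sh s t := s - l - clamp t * (L - l).
have sh_le s t : s - L <= sh s t <= s - l.
  have /andP[t0 t1] := clamp_itv t; rewrite /sh; apply/andP; split; nra.
exists (L + L'), (fun s t => if s <= l then p s else q (sh s t)).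
split=> [||s|s|s t s0|s t sL].
- by rewrite addr_ge0 // (le_trans l0).
- apply: if_continuous; [by cont|by cont| | |].
  + by apply: (@continuous_after _ _ _ fst p) => //; cont.
  + apply: (@continuous_after _ _ _ (fun z : R * R => sh z.1 z.2) q) => //.
    by rewrite /sh; cont.
  + move=> z zl; rewrite zl q0 // (le_trans (andP (sh_le _ _)).2) //.
    by rewrite subrr.
- by rewrite /concat /sh clamp_le0 // mul0r subr0.
- rewrite /concat /sh clamp_ge1 // mul1r.
  case: (leP s l) => [sl|ls]; first by rewrite (le_trans sl).
  case: (leP s L) => sL; last by congr q; ring.
  by rewrite (p1 s (ltW ls)) pq q0 //; lra.
- by rewrite (le_trans s0 l0) concat_left ?p0.
- have ls : l <= L + L' by rewrite (le_trans lL) // lerDl.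
  rewrite concat_right //; case: leP => sl.
    have -> : L + L' = l by lra.
    by rewrite subrr -pq; congr p; lra.
  by rewrite q1 ?[in RHS]q1 //; have /andP[shl _] := sh_le s t; lra.
Qed.

End PathHomotopy.

Lemma is_path_after (R : realType) (Y Z : topologicalType) (g : Y -> Z) L (p : R -> Y) :
  continuous g -> is_path L p -> is_path L (fun s => g (p s)).
Proof.
move=> cg [L0 cp p0 p1]; split=> //; first exact: continuous_after cp cg.
  by move=> s /p0 ->.
by move=> s /p1 ->.
Qed.

Lemma htp_at_after (R : realType) (Y Z : topologicalType) (g : Y -> Z) L
    (p q : R -> Y) K :
  continuous g -> htp_at L p q K ->
  htp_at L (fun s => g (p s)) (fun s => g (q s)) (fun s t => g (K s t)).
Proof.
move=> cg [L0 cK K0 K1 Kb Ka]; split=> //; first exact: continuous_after cK cg.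
- by move=> s; rewrite K0.
- by move=> s; rewrite K1.
- by move=> s t /Kb ->.
- by move=> s t /Ka ->.
Qed.

Lemma concat_after (R : realType) (Y Z : topologicalType) (g : Y -> Z) (L : R)
    (p q : R -> Y) :
  (fun s => g (concat L p q s)) = concat L (fun s => g (p s)) (fun s => g (q s)).
Proof. by apply/funext => s; rewrite /concat; case: ifP. Qed.

(** * The two-dimensional complex of a presentation *)

Section PresentationComplex.
Variables (R : realType) (M : monoidType) (A : finType) (rels : seq (seq A * seq A)).
Variable ev : seq A -> M.
Hypotheses (ev_nil : ev [::] = 1%g)
  (ev_cat : forall u v, ev (u ++ v) = (ev u * ev v)%g)
  (ev_cong : forall u v, pres_cong rels u v -> ev u = ev v).

Local Notation N := (M * M^op)%type.
Local Notation D := (biset M).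
Local Notation stage := (@stage N D).

Definition vertices : nspace N := disc_nspace (free_nset N unit).

Definition vertex_deg (p : vertices) : D :=
  ((p : N * unit).1.1 * (p : N * unit).1.2 : M)%g.

Lemma vertex_deg_continuous : continuous (vertex_deg : vertices -> disc_nspace D).
Proof.
exact: (@discrete_fun_continuous (free_nset N unit) (disc_nspace D) vertex_deg).
Qed.

Lemma vertex_deg_act a p : vertex_deg (nact a p) = sact a (vertex_deg p).
Proof. by rewrite /vertex_deg /= /bi_act /= !mulgA. Qed.

Definition stage0 : stage :=
  @Stage N D vertices (@NMap N vertices (disc_nspace D) vertex_deg
    vertex_deg_continuous vertex_deg_act).

Definition vertex0 (m m' : M) : stage0 := ((m, m' : M^op), tt).

Lemma vertex0_act (a b m m' : M) :
  nact (a, b : M^op) (vertex0 m m') = vertex0 (a * m)%g (m' * b)%g.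
Proof. by []. Qed.

(** Translating by [(m, m')], the edges labelled [x] join [(m, x m')] to
    [(m x, m')]: a letter crosses from the right-hand factor to the left-hand one. *)
Definition edge_ends (x : A) (s : @unit_sphere R 1) : stage0 :=
  if 0 <= set_val s 0 0 then vertex0 1 (ev [:: x]) else vertex0 (ev [:: x]) 1.

Lemma edge_ends_continuous x : continuous (edge_ends x).
Proof.
apply: if_continuous; [by cont| |by cont|by cont|].
  apply: (@continuous_after _ _ _ set_val (fun u : 'rV[R]_1 => u 0 0)); first by cont.
  exact: coord_fun_continuous.
move=> s s0; have := sphereP s; rewrite /sqnorm big_ord1 -s0 expr0n /=.
by move/eqP; rewrite eq_sym oner_eq0.
Qed.

Lemma edge_ends_deg x s : deg (edge_ends x s) = ev [:: x].
Proof.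
by rewrite /edge_ends /deg /=; case: ifP => _; rewrite /vertex_deg /= ?mul1g ?mulg1.
Qed.

Definition edges : attaching R stage0 1 :=
  @Attaching R N D stage0 1 A
    (fun x => SphereMap (@edge_ends_continuous x) (edge_ends_deg x)).

Variable A1 : attachment edges.
Local Notation X1 := (at_stage A1).

Definition vertex (m m' : M) : X1 := at_incl A1 (vertex0 m m').

Lemma vertex_act (a b m m' : M) :
  nact (a, b : M^op) (vertex m m') = vertex (a * m)%g (m' * b)%g.
Proof. by rewrite /vertex -nmap_equivariant. Qed.

Lemma row1_ball (t : R) : sqnorm (const_mx (1 - 2 * clamp t) : 'rV[R]_1) <= 1.
Proof.
rewrite /sqnorm big_ord1 mxE; have /andP[] := clamp_itv t; nra.
Qed.

(** The characteristic map of the 1-cell, run from the point 1 of the ball to -1. *)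
Definition edge (x : A) (t : R) : X1 := at_char A1 1%g x (ball_of (row1_ball t)).

Lemma edge_continuous x : continuous (edge x).
Proof.
apply: (@continuous_after _ _ _ (fun t => ball_of (row1_ball t))).
  apply: to_ball_continuous; apply: row_continuous => i.
  rewrite (_ : (fun _ => _) = fun t => 1 - 2 * clamp t); first by cont.
  by apply/funext => t; rewrite mxE.
exact: at_char_continuous.
Qed.

Lemma edge_end x t (z : R) (z1 : z ^+ 2 = 1) : 1 - 2 * clamp t = z ->
  edge x t =
  at_incl A1 (if 0 <= z then vertex0 1 (ev [:: x]) else vertex0 (ev [:: x]) 1).
Proof.
move=> tz; have hs : sqnorm (const_mx z : 'rV[R]_1) = 1 by rewrite /sqnorm big_ord1 mxE.
rewrite /edge (_ : ball_of _ = sphere_to_ball (sphere_of hs)).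
  rewrite at_char_sphere (nactP stage0).1 /= /edge_ends.
  by rewrite sphere_ofE mxE.
by apply: set_val_inj; rewrite sphere_to_ballE sphere_ofE ball_ofE tz.
Qed.

Lemma edge_before x t : t <= 0 -> edge x t = vertex 1 (ev [:: x]).
Proof.
by move=> t0; rewrite (@edge_end x t 1) ?expr1n ?ler01 // clamp_le0 // mulr0 subr0.
Qed.

Lemma edge_after x t : 1 <= t -> edge x t = vertex (ev [:: x]) 1.
Proof.
move=> t1; rewrite (@edge_end x t (-1)) ?sqrrN ?expr1n //; last first.
  rewrite clamp_ge1 //; ring.
by rewrite ifF //; apply/negbTE; rewrite -ltNge oppr_lt0.
Qed.

Lemma is_path_edge x : is_path 1 (edge x).
Proof.
split=> [//||s s0|s s1]; first exact: edge_continuous.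
  by rewrite !edge_before.
by rewrite !edge_after.
Qed.

(** The letters of [w] cross one by one, from the left: the path goes from
    [vertex 1 (ev w)] to [vertex (ev w) 1]. *)
Fixpoint wpath (w : seq A) : R -> X1 :=
  if w is x :: w' then
    concat 1 (fun s => nact (1%g, ev w' : M^op) (edge x s))
               (fun s => nact (ev [:: x], 1%g : M^op) (wpath w' s))
  else fun _ => vertex 1 1.

Local Notation len w := ((size w)%:R : R).

Lemma wpath_spec w : [/\ is_path (len w) (wpath w), wpath w 0 = vertex 1 (ev w) &
  wpath w (len w) = vertex (ev w) 1].
Proof.
elim: w => [|x w [pw w0 w1]].
  by rewrite ev_nil; split=> //; split=> // s; exact: fun_cst_continuous.
have glue : nact (1%g, ev w : M^op) (edge x 1) =
            nact (ev [:: x], 1%g : M^op) (wpath w 0).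
  by rewrite edge_after // w0 !vertex_act !mul1g !mulg1.
have evx : ev (x :: w) = (ev [:: x] * ev w)%g by rewrite -ev_cat.
rewrite [len _]mulrS; split.
- apply: is_path_concat glue.
    by apply: is_path_after (is_path_edge x); exact: nact_continuous1.
  by apply: is_path_after pw; exact: nact_continuous1.
- by rewrite /= concat_left ?ler01 // edge_before // vertex_act mulg1 evx.
- rewrite /= concat_right ?lerDl // [1 + _]addrC addrK w1 vertex_act.
  by rewrite evx mulg1.
Qed.

Lemma is_path_wpath w : is_path (len w) (wpath w).
Proof. by have [] := wpath_spec w. Qed.
Lemma wpath0 w : wpath w 0 = vertex 1 (ev w).
Proof. by have [] := wpath_spec w. Qed.
Lemma wpath_len w : wpath w (len w) = vertex (ev w) 1.
Proof. by have [] := wpath_spec w. Qed.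

Lemma wpath_before w s : s <= 0 -> wpath w s = vertex 1 (ev w).
Proof. by move=> s0; rewrite (path_before (is_path_wpath w)) // wpath0. Qed.
Lemma wpath_after w s : len w <= s -> wpath w s = vertex (ev w) 1.
Proof. by move=> s0; rewrite (path_after (is_path_wpath w)) // wpath_len. Qed.

Lemma bi_nactM (X : nspace N) (a b c d : M) (x : X) :
  nact (a, b : M^op) (nact (c, d : M^op) x) = nact ((a * c)%g, (d * b)%g : M^op) x.
Proof. by rewrite -(nactP X).2. Qed.

Lemma wpath_glue u w : nact (1%g, ev w : M^op) (wpath u (len u)) =
  nact (ev u, 1%g : M^op) (wpath w 0).
Proof. by rewrite wpath_len wpath0 !vertex_act !mul1g !mulg1. Qed.

Lemma wpath_cat u w : wpath (u ++ w) =
  concat (len u) (fun s => nact (1%g, ev w : M^op) (wpath u s))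
                   (fun s => nact (ev u, 1%g : M^op) (wpath w s)).
Proof.
elim: u => [|x u IHu].
  apply/funext => s; rewrite ev_nil /concat.
  case: leP => s0; last by rewrite subr0 (nactP X1).1.
  by rewrite wpath_before // vertex_act mulg1 mul1g.
rewrite /= IHu concat_after concatA // concat_after [(size u).+1%:R]mulrS.
congr (concat _ (concat _ _ _) _); apply/funext => s.
- by rewrite bi_nactM mulg1 ev_cat.
- by rewrite !bi_nactM !mul1g !mulg1.
- by rewrite bi_nactM mulg1 -ev_cat.
Qed.

Lemma deg_wpath w s : deg (wpath w s) = ev w.
Proof.
rewrite (deg_continuous_path _ 0 (path_continuous (is_path_wpath w))) wpath0.
by rewrite /vertex at_deg_incl /deg /= /vertex_deg /= mul1g.
Qed.

Section Faces.
Variable r : seq_sub rels.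
Local Notation u := (ssval r).1.
Local Notation v := (ssval r).2.

(** A common bound of the two lengths; the summand 1 makes it nonzero, for the
    division in [htp_face]. *)
Definition face_len : R := len u + len v + 1.

Lemma ev_face : ev u = ev v.
Proof. by apply/ev_cong/pres_rel/(ssvalP r). Qed.

(** Both halves of the circle are read from left to right, so the disk itself is a
    homotopy between the two sides of the relation, swept by its vertical chords. *)
Definition face_boundary (s : @unit_sphere R 2) : X1 :=
  let x := face_len * ((set_val s 0 0 + 1) / 2) in
  if 0 <= set_val s 0 1 then wpath u x else wpath v x.

Lemma face_end (x y : R) : x ^+ 2 + y ^+ 2 = 1 -> y = 0 ->
  wpath u (face_len * ((x + 1) / 2)) = wpath v (face_len * ((x + 1) / 2)).
Proof.
move=> xy y0; have x1 : x ^+ 2 = 1 by rewrite -xy y0 expr0n addr0.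
have /orP[/eqP->|/eqP->] : (x == 1) || (x == -1) by rewrite -sqrf_eq1 x1.
  rewrite (_ : (1 + 1) / 2 = 1); last by field.
  rewrite mulr1 /face_len !wpath_after ?ev_face //.
    by rewrite -addrA addrCA lerDl addr_ge0.
  by rewrite -addrA lerDl addr_ge0.
by rewrite addNr mul0r mulr0 !wpath0 ev_face.
Qed.

Lemma face_boundary_continuous : continuous face_boundary.
Proof.
have cs i : continuous (fun s : @unit_sphere R 2 => set_val s 0 i).
  apply: (@continuous_after _ _ _ set_val (fun u : 'rV[R]_2 => u 0 i)); first by cont.
  exact: coord_fun_continuous.
have cx : continuous (fun s : @unit_sphere R 2 => face_len * ((set_val s 0 0 + 1) / 2)).
  by have c0 := cs 0; cont.
apply: if_continuous; [by cont|exact: cs| | |].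
- exact: continuous_after cx (path_continuous (is_path_wpath u)).
- exact: continuous_after cx (path_continuous (is_path_wpath v)).
move=> s s0; apply: (@face_end _ (set_val s 0 1)) => //.
have := sphereP s; rewrite /sqnorm big_ord_recl big_ord1.
by rewrite (_ : lift _ _ = 1) //; exact: val_inj.
Qed.

Lemma face_boundary_deg s : deg (face_boundary s) = ev u.
Proof. by rewrite /face_boundary; case: ifP => _; rewrite deg_wpath ?ev_face. Qed.

End Faces.

Definition faces : attaching R X1 2 :=
  @Attaching R N D X1 2 (seq_sub rels)
    (fun r => SphereMap (@face_boundary_continuous r) (@face_boundary_deg r)).

Variable A2 : attachment faces.
Local Notation X2 := (at_stage A2).

Definition row2 (x y : R) : 'rV[R]_2 := \row_i (if i == 0 then x else y).

Lemma sqnorm_row2 x y : sqnorm (row2 x y) = x ^+ 2 + y ^+ 2.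
Proof. by rewrite /sqnorm big_ord_recl big_ord1 !mxE. Qed.

(** The second coordinate of the point reached at time [t] on the vertical chord at
    [x], which is run from top to bottom. *)
Definition chord (x t : R) : R := (1 - 2 * clamp t) * Num.sqrt (1 - x ^+ 2).

Lemma chord_ball (s t : R) :
  sqnorm (row2 (2 * clamp s - 1) (chord (2 * clamp s - 1) t)) <= 1.
Proof.
rewrite sqnorm_row2; set x := 2 * clamp s - 1.
have x1 : x ^+ 2 <= 1 by have /andP[] := clamp_itv s; rewrite /x; nra.
have y1 : (1 - 2 * clamp t) ^+ 2 <= 1 by have /andP[] := clamp_itv t; nra.
rewrite /chord exprMn sqr_sqrtr ?subr_ge0 //.
rewrite -lerBrDl ler_piMl // subr_ge0 //.
Qed.

Lemma htp_face (r : seq_sub rels) :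
  htp (fun s => at_incl A2 (wpath (ssval r).1 s))
      (fun s => at_incl A2 (wpath (ssval r).2 s)).
Proof.
set u := (ssval r).1; set v := (ssval r).2; pose L := face_len r.
have L0 : 0 < L by rewrite ltr_wpDl // addr_ge0.
have uL : len u <= L by rewrite /L /face_len -addrA lerDl addr_ge0.
have vL : len v <= L by rewrite /L /face_len -addrA addrCA lerDl addr_ge0.
pose K s t := at_char A2 1%g r (ball_of (chord_ball (s / L) t)).
have Kboundary s t y : chord (2 * clamp (s / L) - 1) t = y ->
    (2 * clamp (s / L) - 1) ^+ 2 + y ^+ 2 = 1 ->
    K s t = at_incl A2 (if 0 <= y then wpath u (L * clamp (s / L))
                        else wpath v (L * clamp (s / L))).
  move=> <- hs; rewrite -sqnorm_row2 in hs.
  rewrite /K (_ : ball_of _ = sphere_to_ball (sphere_of hs)); last first.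
    by apply: set_val_inj; rewrite sphere_to_ballE sphere_ofE ball_ofE.
  rewrite at_char_sphere (nactP X1).1 /= /face_boundary sphere_ofE !mxE /= -/L.
  by rewrite subrK [2 * _]mulrC mulfK ?pnatr_eq0.
have clampL w s : len w <= L -> wpath w (L * clamp (s / L)) = wpath w s.
  move=> wL; have [s0|s0] := leP s 0.
    by rewrite clamp_le0 ?pmulr_lle0 ?invr_gt0 // mulr0 wpath0 wpath_before.
  have [sL|sL] := leP L s.
    rewrite clamp_ge1 ?ler_pdivlMr ?mul1r // mulr1 !wpath_after //.
    exact: le_trans sL.
  rewrite clamp_id; last first.
    by rewrite divr_ge0 ?(ltW s0) ?(ltW L0) // ler_pdivrMr // mul1r ltW.
  by rewrite mulrC divfK // gt_eqF.
have sq1 s : 0 <= 1 - (2 * clamp s - 1) ^+ 2.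
  by rewrite subr_ge0; have /andP[] := clamp_itv s; nra.
have Kends s t (z : R) : (2 * clamp (s / L) - 1) ^+ 2 = 1 ->
    K s t = at_incl A2 (wpath u (L * clamp (s / L))).
  move=> x1; rewrite (Kboundary s t 0) ?lexx //; last by rewrite x1 expr0n addr0.
  by rewrite /chord x1 subrr sqrtr0 mulr0.
exists L, K; split.
- exact: ltW.
- apply: (@continuous_after _ _ _
    (fun z : R * R => ball_of (chord_ball (z.1 / L) z.2))).
    apply: to_ball_continuous; apply: row_continuous => i.
    have [i0|i0] := eqVneq i 0.
      rewrite (_ : (fun _ => _) = fun z : R * R => 2 * clamp (z.1 / L) - 1).
        by cont.
      by apply/funext => z; rewrite mxE i0.
    rewrite (_ : (fun _ => _) = fun z : R * R => chord (2 * clamp (z.1 / L) - 1) z.2).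
      by rewrite /chord; cont.
    by apply/funext => z; rewrite mxE (negbTE i0).
  exact: at_char_continuous.
- move=> s; rewrite (Kboundary s 0 (Num.sqrt (1 - (2 * clamp (s / L) - 1) ^+ 2))).
  + by rewrite sqrtr_ge0 clampL.
  + by rewrite /chord clamp_le0 // mulr0 subr0 mul1r.
  + by rewrite sqr_sqrtr ?sq1 // addrC subrK.
- move=> s; pose y := Num.sqrt (1 - (2 * clamp (s / L) - 1) ^+ 2).
  have yE : y ^+ 2 = 1 - (2 * clamp (s / L) - 1) ^+ 2 by rewrite sqr_sqrtr ?sq1.
  rewrite (Kboundary s 1 (- y)).
  + rewrite oppr_ge0 le_eqVlt ltNge sqrtr_ge0 orbF; case: eqP => [y0|_].
      rewrite -[RHS](congr1 _ (clampL v s vL)); congr (at_incl A2 _).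
      have := @face_end r (2 * clamp (s / L) - 1) y.
      rewrite subrK [2 * _]mulrC mulfK ?pnatr_eq0 // => -> //; rewrite yE; ring.
    by rewrite clampL.
  + rewrite /chord clamp_ge1 // -/y; ring.
  + rewrite sqrrN yE; ring.
- move=> s t s0; have c0 : clamp (s / L) = 0.
    by rewrite clamp_le0 // pmulr_lle0 // invr_gt0.
  rewrite Kends // c0; last by ring.
  by rewrite mulr0.
- move=> s t sL; have c1 : clamp (s / L) = 1.
    by rewrite clamp_ge1 // ler_pdivlMr // mul1r.
  rewrite Kends // c1; last by ring.
  by rewrite mulr1.
Qed.

Local Notation wpath2 w := (fun s => at_incl A2 (wpath w s)).

(** Induction on the derivation of the congruence. In the case of a product, the
    concatenations are first brought to a common length by pausing. *)
Lemma htp_cong u v : pres_cong rels u v -> htp (wpath2 u) (wpath2 v).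
Proof.
have path2 w : is_path (len w) (wpath2 w).
  by apply: is_path_after (is_path_wpath w); exact: nmap_continuous.
elim=> {u v} [r rr|u|u v _|u v w _ uv _|u u' v v' cuv IH cuv' IH'].
- exact: (htp_face (SeqSub rr)).
- exact: htp_refl (path2 u).
- exact: htp_sym.
- exact: htp_trans.
have pathN w (b : N) : is_path (len w) (fun s => nact b (at_incl A2 (wpath w s))).
  by apply: is_path_after (path2 w); exact: nact_continuous1.
have catE w w' : wpath2 (w ++ w') =
    concat (len w) (fun s => nact (1%g, ev w' : M^op) (at_incl A2 (wpath w s)))
                     (fun s => nact (ev w, 1%g : M^op) (at_incl A2 (wpath w' s))).
  rewrite wpath_cat concat_after; congr concat.
  - by apply/funext => s; rewrite nmap_equivariant.
  - by apply/funext => s; rewrite nmap_equivariant.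
have glue w w' : nact (1%g, ev w' : M^op) (at_incl A2 (wpath w (len w))) =
    nact (ev w, 1%g : M^op) (at_incl A2 (wpath w' 0)).
  by rewrite -!nmap_equivariant wpath_glue.
have [L1 [K hK]] := IH; have [L2 [K' hK']] := IH'.
pose L := Num.max (Num.max L1 L2) (Num.max (len u) (len v)).
have uL : len u <= L by rewrite /L !le_max lexx !orbT.
have vL : len v <= L by rewrite /L !le_max lexx !orbT.
have {}hK : htp_at L (wpath2 u) (wpath2 v) K.
  by apply: htp_at_widen hK; rewrite /L !le_max lexx.
have {}hK' : htp_at L (wpath2 u') (wpath2 v') K'.
  by apply: htp_at_widen hK'; rewrite /L !le_max lexx !orbT.
rewrite !catE.
apply: htp_trans (htp_pause (pathN u _) (pathN u' _) (glue u u') uL) _.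
apply: htp_trans (htp_sym (htp_pause (pathN v _) (pathN v' _) (glue v v') vL)).
rewrite (ev_cong cuv) (ev_cong cuv').
apply: htp_concat (htp_at_after _ hK) (htp_at_after _ hK') _.
- exact: nact_continuous1.
- exact: nact_continuous1.
- by rewrite (path_after (pathN u _)) // -(ev_cong cuv') glue (ev_cong cuv).
Qed.


Variable word : M -> seq A.
Hypotheses (wordK : cancel word ev)
  (cong_of_ev : forall u v, ev u = ev v -> pres_cong rels u v).

Definition base1 (d : D) : X1 := vertex 1 d.

Lemma base1_deg d : deg (base1 d) = d.
Proof. by rewrite /base1 /vertex at_deg_incl /deg /= /vertex_deg /= mul1g. Qed.

(** Each vertex waits during the first half of the time, in which the edges at
    that vertex deform, and then runs back along its normal form. *)
Definition contract0 (p : stage0) (t : R) : X1 :=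
  let w := word (p : N * unit).1.1 in
  nact (1%g, (p : N * unit).1.2) (wpath w (len w * (1 - clamp (2 * t - 1)))).

Lemma contract0E (m m' : M) t : contract0 (vertex0 m m') t =
  nact (1%g, m' : M^op) (wpath (word m) (len (word m) * (1 - clamp (2 * t - 1)))).
Proof. by []. Qed.

Lemma contraction0 : contracting_homotopy (at_incl A1) base1 contract0.
Proof.
split.
- apply: (@discrete_prod_continuous (free_nset N unit) R X1 contract0) => p.
  apply: (@continuous_after _ _ _ _ (nact _)); last exact: nact_continuous1.
  apply: continuous_after (path_continuous (is_path_wpath _)); by cont.
- move=> [[m m'] []] t t0; rewrite contract0E clamp_le0; last lra.
  by rewrite subr0 mulr1 wpath_len wordK vertex_act mul1g mul1g.
- move=> [[m m'] []] t t1; rewrite contract0E clamp_ge1; last lra.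
  by rewrite subrr mulr0 wpath0 wordK vertex_act mulg1.
Qed.

Lemma wpath_letter x : wpath [:: x] = edge x.
Proof.
apply/funext => s; rewrite /= ev_nil /concat; case: leP => [s1|/ltW s1].
  by rewrite (nactP X1).1.
by rewrite vertex_act mulg1 mul1g edge_after.
Qed.

Lemma coord_ball1 (z : @unit_ball R 1) : -1 <= set_val z 0 0 <= 1.
Proof.
have := ballP z; rewrite /sqnorm big_ord1 => z1; apply/andP; split; nra.
Qed.

(** Let [w] and [w'] be the normal forms of [m] and of [m x], and let [K] be a homotopy
    from the path of [w x] to that of [w']. The square over the edge from
    [(m, x m')] to [(m x, m')] is [K] composed with a map of the square to the plane:
    at the position [y] on the edge the time [t] is sent to [(S y t, c2 t * y)],
    a motion of segments in five key positions (with [l], [l'] the lengths of [w],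
    [w'] and [L1] a length at which [K] has ended):
    - at first [y |-> (l + y, 0)], the last edge of the path of [w x];
    - then [y |-> (l + y (L1 - l), 0)], where its end point is far out, and
    - [y |-> (l + y (L1 - l), y)], where that end point has moved to the path of [w'];
    - then [y |-> (l + y (l' - l), y)], ending where the path of [w'] ends;
    - finally [y |-> (0, y)], all at the base point.
    During the first four, up to time one half, the images under [K] of both ends are
    constant; from the fourth to the last they run back along the paths of [w] and
    [w'], as in [contract0]. *)
Lemma fill_edge b x : fillable (at_incl A2) base1 contract0 b x.
Proof.
case: b => m m'; pose w := word m; pose w' := word (m * ev [:: x])%g.
have ev_w : ev w = m by exact: wordK.
have ev_w' : ev w' = (m * ev [:: x])%g by exact: wordK.
pose l := len w; pose l' := len w'.
have [L [K hK]] : htp (wpath2 (w ++ [:: x])) (wpath2 w').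
  by apply: htp_cong; apply: cong_of_ev; rewrite ev_cat ev_w ev_w'.
pose L1 := Num.max L (Num.max (l + 1) l').
have lL : l + 1 <= L1 by rewrite /L1 !le_max lexx !orbT.
have l'L : l' <= L1 by rewrite /L1 !le_max lexx !orbT.
have {}hK : htp_at L1 (wpath2 (w ++ [:: x])) (wpath2 w') K.
  by apply: htp_at_widen hK; rewrite /L1 le_max lexx.
have [_ cK K0 K1 Kb Ka] := hK.
have l0 : 0 <= l by exact: ler0n.
have l'0 : 0 <= l' by exact: ler0n.
have len_wx : len (w ++ [:: x]) = l + 1 by rewrite size_cat natrD.
have wx_left s : s <= l -> wpath (w ++ [:: x]) s =
    nact (1%g, ev [:: x] : M^op) (wpath w s).
  by move=> sl; rewrite wpath_cat concat_left.
have wx_right s : 0 <= s -> wpath (w ++ [:: x]) (l + s) =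
    nact (m, 1%g : M^op) (edge x s).
  move=> s0; rewrite wpath_cat concat_right ?lerDl //; last exact: wpath_glue.
  by rewrite -/l addrAC subrr add0r wpath_letter ev_w.
have wx_end s : l + 1 <= s -> wpath (w ++ [:: x]) s = wpath (w ++ [:: x]) L1.
  by move=> sl; rewrite !wpath_after // len_wx.
pose c1 (t : R) := clamp (6 * t); pose c2 (t : R) := clamp (6 * t - 1).
pose c3 (t : R) := clamp (6 * t - 2); pose c4 (t : R) := clamp (2 * t - 1).
pose S (y t : R) :=
  (l + y * (1 + c1 t * (L1 - l - 1)) - c3 t * y * (L1 - l')) * (1 - c4 t).
pose Q (y t : R) := nact (1%g, m') (K (S y t) (c2 t * y)).
have cQ : continuous (fun z : R * R => Q z.1 z.2).
  apply: (@continuous_after _ _ _ _ (nact _)); last exact: nact_continuous1.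
  apply: (@continuous_after _ _ _ (fun z : R * R => (S z.1 z.2, c2 z.2 * z.1)) _ _ cK).
  by rewrite /S /c1 /c2 /c3 /c4; cont.
have Q_start (y t : R) : 0 <= y -> t <= 0 ->
    Q y t = at_incl A2 (nact (m, m' : M^op) (edge x y)).
  move=> y0 t0; rewrite /Q /S.
  have -> : c1 t = 0 by rewrite /c1 clamp_le0 //; lra.
  have -> : c2 t = 0 by rewrite /c2 clamp_le0 //; lra.
  have -> : c3 t = 0 by rewrite /c3 clamp_le0 //; lra.
  have -> : c4 t = 0 by rewrite /c4 clamp_le0 //; lra.
  rewrite [0 * y]mul0r (_ : _ * (1 - 0) = l + y); last by ring.
  rewrite K0 wx_right //.
  by rewrite -nmap_equivariant bi_nactM !mul1g.
have Q_end (y t : R) : 1 <= t -> Q y t = at_incl A2 (base1 (m * ev [:: x] * m' : M)%g).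
  move=> t1; rewrite /Q /S.
  have -> : c4 t = 1 by rewrite /c4 clamp_ge1 //; lra.
  rewrite subrr mulr0 Kb // wpath0 ev_cat ev_w -nmap_equivariant vertex_act.
  by rewrite mul1g.
have Q_zero t : Q 0 t = at_incl A2 (contract0 (vertex0 m (ev [:: x] * m' : M)%g) t).
  have /andP[c40 c41] : 0 <= c4 t <= 1 by exact: clamp_itv.
  rewrite /Q /S mul0r mulr0 mul0r subr0 addr0 mulr0 K0 wx_left; last first.
    by rewrite ler_piMr // gerBl.
  by rewrite -nmap_equivariant bi_nactM mul1g contract0E.
have Q_one t : Q 1 t = at_incl A2 (contract0 (vertex0 (m * ev [:: x])%g (m' : M)) t).
  rewrite contract0E nmap_equivariant -/w' -/l' -/(c4 t) /Q; congr nact.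
  rewrite /S mul1r !mulr1.
  have w'_end s : l' <= s -> wpath w' s = wpath w' l'.
    by move=> sl; rewrite !wpath_after.
  have /andP[c10 c11] : 0 <= c1 t <= 1 by exact: clamp_itv.
  have /andP[c30 c31] : 0 <= c3 t <= 1 by exact: clamp_itv.
  have [t3|t3] := leP (2^-1) t.
    have -> : c1 t = 1 by rewrite /c1 clamp_ge1 //; lra.
    have -> : c2 t = 1 by rewrite /c2 clamp_ge1 //; lra.
    have -> : c3 t = 1 by rewrite /c3 clamp_ge1 //; lra.
    by rewrite K1; congr (at_incl A2 (wpath w' _)); ring.
  have -> : c4 t = 0 by rewrite /c4 clamp_le0 //; lra.
  rewrite subr0 !mulr1.
  have [t2|t2] := leP (3^-1) t.
    have -> : c1 t = 1 by rewrite /c1 clamp_ge1 //; lra.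
    have -> : c2 t = 1 by rewrite /c2 clamp_ge1 //; lra.
    by rewrite K1 w'_end //; nra.
  have -> : c3 t = 0 by rewrite /c3 clamp_le0 //; lra.
  have [_ KL] := htp_at_ends hK.
  have [t1|t1] := leP (6^-1) t.
    have -> : c1 t = 1 by rewrite /c1 clamp_ge1 //; lra.
    by rewrite Ka; [rewrite KL w'_end | lra].
  have -> : c2 t = 0 by rewrite /c2 clamp_le0 //; lra.
  by rewrite K0 wx_end ?KL ?w'_end //; nra.
(* The ball point 1 is the start of the edge, y = 0, and -1 is its end, y = 1. *)
exists (fun (z : @unit_ball R 1) t => Q ((1 - set_val z 0 0) / 2) t); split.
- apply: (@continuous_after _ _ _
    (fun z : @unit_ball R 1 * R => ((1 - set_val z.1 0 0) / 2, z.2)) _ _ cQ).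
  have cz : continuous (fun z : @unit_ball R 1 * R => set_val z.1 0 0).
    apply: (@continuous_after _ _ _ (fun z : @unit_ball R 1 * R => set_val z.1)
      (fun u : 'rV[R]_1 => u 0 0)); last exact: coord_fun_continuous.
    by apply: (@continuous_after _ _ _ fst); cont.
  by cont.
- move=> s t; rewrite sphere_to_ballE [att_map x s]/(edge_ends x s) /edge_ends.
  have /eqP : set_val s 0 0 ^+ 2 = 1.
    by have := sphereP s; rewrite /sqnorm big_ord1.
  rewrite sqrf_eq1 => /orP[/eqP ->|/eqP ->].
    by rewrite subrr mul0r ler01 Q_zero vertex0_act mulg1.
  rewrite (_ : (1 - -1) / 2 = 1); last by field.
  rewrite ifF; last by apply/negbTE; rewrite -ltNge oppr_lt0.
  by rewrite Q_one vertex0_act mul1g.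
- move=> z t t0; have /andP[z0 z1] := coord_ball1 z.
  rewrite Q_start //; last lra.
  rewrite /edge at_char_act; congr (at_incl A2 (at_char A1 _ _ _)).
    by congr (_, _); exact: mulg1.
  apply: set_val_inj; rewrite ball_ofE; apply/rowP => i; rewrite !mxE ord1.
  by rewrite clamp_id; [field|apply/andP; split; lra].
- by move=> z t t1; rewrite Q_end.
Qed.

End PresentationComplex.

(** * Components of a space contracted over its degree *)

Section Components.
Variables (R : realType) (N : monoidType) (D : nset N).
Variables (X : stage D) (o : D -> X) (H : X -> R -> X).

Definition nmap_id (Y : nspace N) : nmap Y Y :=
  @NMap N Y Y id (fun y => @cvg_id _ (nbhs y)) (fun _ _ => erefl).

Hypotheses (dego : forall d, deg (o d) = d)
  (ctrH : contracting_homotopy (nmap_id X) o H).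

Lemma path_along (x : X) t : path_connected_to R x (H x t).
Proof.
have [cH H0 _] := ctrH; exists (fun s => H x (t * s)); split.
- apply: continuous_subspaceT.
  apply: (@continuous_after _ _ _ (fun s => t * s) (H x)); first by cont.
  exact: continuous_section cH.
- by rewrite mulr0 H0.
- by rewrite mulr1.
Qed.

Lemma path_to_base (x : X) : path_connected_to R x (o (deg x)).
Proof. by have := path_along x 1; rewrite (ctr_end ctrH). Qed.

Lemma deg_pathP (x y : X) : path_connected_to R x y <-> deg x = deg y.
Proof.
split=> [|xy]; first exact: deg_path.
apply: pc_trans (path_to_base x) _; rewrite xy; apply: pc_sym; exact: path_to_base.
Qed.

Local Open Scope quotient_scope.

Lemma pi0_iso : nset_iso (pi0_nset R X) D.
Proof.
pose f (c : pi0_nset R X) : D := @deg N D X (repr (c : pi0 R X)).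
have fE (x : X) : f (\pi_(pi0 R X) x) = deg x.
  by apply/deg_pathP/asboolP/pi0P; rewrite reprK.
exists f; split=> [a c|].
  by rewrite -[c in LHS]reprK /= pi0_act_pi fE deg_act.
exists (fun d => \pi_(pi0 R X) (o d)) => [c|d]; last by rewrite fE.
rewrite -[RHS]reprK; apply/pi0P/asboolP/deg_pathP; exact: dego.
Qed.

(** A contraction preserves the degree, hence each component. *)
Lemma component_contractible (x : X) : contractible R (path_component R x).
Proof.
have [cH H0 H1] := ctrH.
pose C := path_component R x.
have inC (y : C) t : C (H (set_val y) t).
  by apply: pc_trans (path_along (set_val y) t); exact: (set_valP y).
pose Hx (z : C * R) : C := in_set_type (inC z.1 z.2).
exists (in_set_type (path_to_base x)), Hx; split=> [|y|y].
- apply: continuous_subspaceT; apply: continuous_to_set.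
  apply: (@continuous_after _ _ _ (fun z : C * R => (set_val z.1, z.2)) _ _ cH).
  apply: fun_pair_continuous; last by cont.
  by apply: (@continuous_after _ _ _ fst); cont.
- by apply: set_val_inj; rewrite in_set_typeE H0.
- apply: set_val_inj; rewrite !in_set_typeE /= H1 //; congr o.
  by apply/esym/deg_pathP; exact: (set_valP y).
Qed.

End Components.

(** * Killing all higher spheres *)

Section KillingTower.
Variables (R : realType) (N : monoidType) (D : nset N).
Variables (S0 : stage D) (a1 : attaching R S0 1) (A1 : attachment a1).
Variables (a2 : attaching R (at_stage A1) 2) (A2 : attachment a2).

(** The index is shifted: [kill k] has dimension [k.+2], so the next cells to be
    attached have dimension [k.+3]. *)
Fixpoint kill (k : nat) : stage D :=
  if k is k'.+1 then at_stage (attach (all_spheres R (kill k') k'.+3))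
  else at_stage A2.

Definition skel (n : nat) : stage D :=
  match n with 0 => S0 | 1 => at_stage A1 | k.+2 => kill k end.

Definition skel_att (n : nat) : attaching R (skel n) n.+1 :=
  match n with 0 => a1 | 1 => a2 | k.+2 => all_spheres R (kill k) k.+3 end.

Definition skel_incl (n : nat) : nmap (skel n) (skel n.+1) :=
  match n with
  | 0 => at_incl A1 | 1 => at_incl A2
  | k.+2 => at_incl (attach (all_spheres R (kill k) k.+3)) end.

Definition skel_char (n : nat) :
    nmap (cells_ball R (cells (skel_att n)) n.+1) (skel n.+1) :=
  match n with
  | 0 => at_cells A1 | 1 => at_cells A2
  | k.+2 => at_cells (attach (all_spheres R (kill k) k.+3)) end.

Lemma skel_pushout n :
  is_pushout (attach_nmap (skel_att n)) (cells_incl R (cells (skel_att n)) n.+1)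
             (skel_incl n) (skel_char n).
Proof. by case: n => [|[|k]]; exact: at_pushout. Qed.

Lemma skel_incl_deg n x : deg (skel_incl n x) = deg x.
Proof. by case: n x => [|[|k]] x; exact: at_deg_incl. Qed.

Variables (o1 : D -> at_stage A1) (H0 : S0 -> R -> at_stage A1).
Hypotheses (dego1 : forall d, deg (o1 d) = d)
  (ctrH0 : contracting_homotopy (at_incl A1) o1 H0)
  (fill1 : forall b j, fillable (at_incl A2) o1 H0 b j).

Fixpoint skel_base (n : nat) : D -> skel n.+1 :=
  if n is n'.+1 then fun d => skel_incl n'.+1 (skel_base n' d) else o1.

Lemma skel_base_deg n d : deg (skel_base n d) = d.
Proof.
elim: n => [|n IHn]; first exact: dego1.
exact: etrans (@skel_incl_deg n.+1 _) IHn.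
Qed.

(** The cylinders on the cells of [a1] have to be filled in [at_stage A2], whose
    cells are not attached along every sphere; so fillability is part of the
    induction hypothesis in dimension 0, and automatic afterwards. *)
Definition skel_contracting n (H : skel n -> R -> skel n.+1) : Prop :=
  contracting_homotopy (skel_incl n) (skel_base n) H /\
  match n return (skel n -> R -> skel n.+1) -> Prop with
  | 0 => fun H => forall b j, fillable (at_incl A2) o1 H b j
  | _ => fun _ => True
  end H.

Lemma skel_contracting_extend n (H : skel n -> R -> skel n.+1) :
  skel_contracting H -> exists H' : skel n.+1 -> R -> skel n.+2,
    skel_contracting H' /\
    forall x t, H' (skel_incl n x) t = skel_incl n.+1 (H x t).
Proof.
move=> [ctrH fillH]; have degb := skel_base_deg n.
case: n H ctrH fillH degb => [|[|k]] H ctrH fillH degb.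
- have [H' [ctrH' H'E]] := extend_contraction ctrH fillH.
  by exists H'; split.
- have fill := all_spheres_fillable (attach (all_spheres R (kill 0) 3)) degb ctrH.
  have [H' [ctrH' H'E]] := extend_contraction ctrH fill.
  by exists H'; split.
- have fill := all_spheres_fillable (attach (all_spheres R (kill k.+1) k.+4)) degb ctrH.
  have [H' [ctrH' H'E]] := extend_contraction ctrH fill.
  by exists H'; split.
Qed.

Lemma skel_contractings : exists H : forall n, skel n -> R -> skel n.+1,
  (forall n, skel_contracting (H n)) /\
  forall n x t, H n.+1 (skel_incl n x) t = skel_incl n.+1 (H n x t).
Proof.
pose C n := {H : skel n -> R -> skel n.+1 | skel_contracting H}.
have C0 : C 0%N by exists H0; split.
pose next n (c : C n) := cid (skel_contracting_extend (svalP c)).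
pose seqC := fix F n : C n :=
  if n is n'.+1 then exist _ (sval (next n' (F n'))) (svalP (next n' (F n'))).1
  else C0.
exists (fun n => sval (seqC n)); split=> [n|n x t]; first exact: svalP.
exact: (svalP (next n (seqC n))).2.
Qed.

Definition total_colimit := nspace_seq_colimit (fun n => skel_incl n).
Local Notation X := (colim total_colimit).

Lemma total_deg : exists d : nmap X (disc_nspace D),
  forall n x, d (colim_in total_colimit n x) = deg x.
Proof.
have [|h [hE _]] := (seq_colimit_nspaceP total_colimit).2 _ (fun n => st_deg (skel n)).
  by move=> n x; exact: skel_incl_deg.
by exists h.
Qed.

Definition total : stage D := Stage (sval (cid total_deg)).

Definition to_total n : nmap (skel n) total := colim_in total_colimit n.

Lemma deg_to_total n x : deg (to_total n x) = deg x.
Proof. exact: (svalP (cid total_deg)). Qed.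

Definition total_base (d : D) : total := to_total 1 (o1 d).

Lemma to_total_base n d : to_total n.+1 (skel_base n d) = total_base d.
Proof.
elim: n => // n <-; exact: (@colim_incl _ _ _ total_colimit n.+1).
Qed.

Lemma total_base_deg d : deg (total_base d) = d.
Proof. by rewrite deg_to_total dego1. Qed.

(** The homotopies glue because the limit of the skeleta is also a limit for maps
    into the space of paths. *)
Lemma total_contracting : exists H : total -> R -> total,
  contracting_homotopy (nmap_id total) total_base H.
Proof.
have [H [ctrH HE]] := skel_contractings.
pose u n (x : skel n) (t : R) : total := to_total n.+1 (H n x t).
have cu n : continuous (fun z : skel n * R => u n z.1 z.2).
  by apply: (continuous_after (ctr_continuous (ctrH n).1)); exact: nmap_continuous.
have [||h [ch hE]] := colim_lift total_colimit
    (Z := {compact-open, R -> total}) (u := u).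
- by move=> n; exact: curry_path_continuous.
- move=> n x; apply/funext => t; rewrite /u HE.
  exact: (@colim_incl _ _ _ total_colimit n.+1).
exists h; split.
- apply: uncurry_path_continuous => // y; have [n [x <-]] := colim_surj y.
  by rewrite hE; exact: continuous_section.
- move=> y t t0; have [n [x <-]] := colim_surj y; rewrite hE /u.
  rewrite (ctr_start (ctrH n).1) //.
  exact: (@colim_incl _ _ _ total_colimit n).
- move=> y t t1; have [n [x <-]] := colim_surj y; rewrite hE /u.
  by rewrite (ctr_end (ctrH n).1) // to_total_base -/(to_total n x) deg_to_total.
Qed.

Section CW.
Variables (P0 : nset N) (base : nmap (disc_nspace P0) S0).
Hypotheses (P0_proj : projective P0) (baseP : nhomeo base).

Definition total_cells (n : nat) : nset N :=
  if n is n'.+1 then cells (skel_att n') else P0.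

Lemma total_cells_projective n : projective (total_cells n).
Proof. by case: n => [|n]; [exact: P0_proj|exact: free_projective]. Qed.

Definition total_cw : projective_cw R total :=
  @ProjectiveCW R N total total_cells total_cells_projective
    (fun n => skel n : nspace N) base baseP skel_incl
    (fun n => attach_nmap (skel_att n)) skel_char skel_pushout
    to_total (seq_colimit_nspaceP total_colimit).

End CW.
End KillingTower.

(** * Finitely presented monoids *)

Theorem theorem7p12 (R : realType) (M : monoidType) :
  finitely_presented M -> type_bi_F R 2 M.
Proof.
move=> [A [rels [f [[f1 fM] [g fK gK]]]]].
pose ev (w : seq A) : M := f (\pi_(pres_monoid rels)%qT w).
have ev_cong u v : pres_cong rels u v -> ev u = ev v.
  by move=> uv; congr f; apply/pres_piP/asboolP.
have cong_of_ev u v : ev u = ev v -> pres_cong rels u v.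
  by move=> /(can_inj fK) /pres_piP /asboolP.
have ev_cat u v : ev (u ++ v) = (ev u * ev v)%g.
  rewrite /ev -fM; congr f; apply/pres_piP/asboolP.
  by apply: pres_cat; apply: pres_sym; exact: pres_repr.
pose word m : seq A := repr (g m).
have wordK : cancel word ev by move=> m; rewrite /ev /word reprK gK.
pose A1 := attach (edges R ev); pose A2 := attach (faces f1 ev_cat ev_cong A1).
have ctr0 := contraction0 f1 ev_cat A1 wordK.
have fill := fill_edge A2 wordK cong_of_ev.
have degb := base1_deg A1.
have base : nhomeo (nmap_id (disc_nspace (free_nset (M * M^op)%type unit))).
  by exists (nmap_id _).
pose X := total A2.
pose cw := total_cw A2 (@free_projective _ unit) base.
have [H ctrH] := total_contracting degb ctr0 fill.
have degX := total_base_deg A2 degb.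
exists (BiClassifyingSpace cw (pi0_iso degX ctrH) (component_contractible ctrH)).
by case=> [|[|[|]]] //= _; exact: free_fin_gen.
Qed.
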